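(* Let $\tau\in\Omega$, $\lambda,\mu\in X_*$, $w\in W$, $1\le i\le r$, and let $\alpha_i$ be the simple root corresponding to $s_i$. Let $\varphi\in R$ be the positive root such that $H_{\varphi,1}=\{x\in X_{*,\mathbb R}:\langle\varphi,x\rangle=1\}$ is the wall of $\mathbf a$ which is not a wall of the Weyl chamber in which $\mathbf a$ lies. Then the following hold in $\mathcal H$: (1) $\theta_\lambda\theta_\mu=\theta_{\lambda+\mu}$. (2) $t_{s_i}t_w=t_{s_iw}$ if $\ell(s_iw)>\ell(w)$, and $t_{s_i}t_w=t_{s_iw}+(q^{1/2}-q^{-1/2})\,t_w$ otherwise. (3) $t_{s_i}\theta_\lambda=\theta_{s_i\lambda}t_{s_i}+(q^{1/2}-q^{-1/2})\,\dfrac{\theta_\lambda-\theta_{s_i\lambda}}{1-\theta_{-\alpha_i^\vee}}$. (4) $\Phi(c_0^+)\,t_{s_\varphi}=\theta_{\varphi^\vee}$, where $s_\varphi\in W$ is the reflection associated with $\varphi$. (5) If $\lambda\in X_*$ is the image of the origin under $\tau\in\Omega$, then $\theta_\lambda=T_\tau t_{w_0w'}$, where $w'$ is the longest element of the stabilizer $W_\lambda$ of $\lambda$ in $W$ and $w_0$ is the longest element of $W$.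
   Context: Let $(X^*,X_*,R,R^\vee,\Delta)$ be a reduced and irreducible based root datum, $\Delta$ the set of simple roots, $r=\#\Delta$, $W$ the finite Weyl group, generated by the simple reflections $s_1,\dots,s_r$, and $\widetilde W=X_*\rtimes W$ the extended affine Weyl group, acting on $X_{*,\mathbb R}=X_*\otimes\mathbb R$; $\epsilon^\lambda\in\widetilde W$ denotes the translation by $\lambda\in X_*$. Let $\alpha_0$ be the highest root, $s_0=\epsilon^{\alpha_0^\vee}s_{\alpha_0}$, $S_a=\{s_0,\dots,s_r\}$, and $W_a\subseteq\widetilde W$ the affine Weyl group generated by $S_a$. The affine root hyperplanes are $H_{\alpha,n}=\{x\in X_{*,\mathbb R}:\langle\alpha,x\rangle=n\}$ for $\alpha\in R$, $n\in\mathbb Z$. Alcoves are the connected components of the complement of their union; the base alcove $\mathbf a$ is the alcove in the dominant Weyl chamber whose closure contains the origin. The wall of type $i$ of $\mathbf a$ is the hyperplane fixed by $s_i$, and the wall of type $i$ of $x\mathbf a$ ($x\in W_a$) is its image under $x$. Length function on $\widetilde W$: $\ell(w\epsilon^\lambda)=\sum_{\alpha>0,\,w(\alpha)<0}|\langle\alpha,\lambda\rangle+1|+\sum_{\alpha>0,\,w(\alpha)>0}|\langle\alpha,\lambda\rangle|$. $\Omega\subseteq\widetilde W$ is the subgroup of elements of length $0$ (the stabilizer of $\mathbf a$). Fix a commutative ring $k$, an invertible $v\in k$, put $q=v^2$, and write $q^{1/2}$ for $v$. The braid group of $\widetilde W$ has generators $T_w$ ($w\in\widetilde W$) and relations $T_wT_{w'}=T_{ww'}$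 whenever $\ell(ww')=\ell(w)+\ell(w')$. The affine Hecke algebra $\mathcal H$ is the quotient of the group algebra over $k$ of this braid group by the two-sided ideal generated by $(T_s+1)(T_s-q)$, $s\in S_a$. Put $\tilde T_w=q^{-\ell(w)/2}T_w$ and $\tilde T_i=\tilde T_{s_i}$. Alcove walks. We use the standard orientation: for each positive root $\alpha$ and $j\in\mathbb Z$ the positive side of $H_{\alpha,j}$ is $\{x:\langle\alpha,x\rangle>j\}$ and the negative side is $\{x:\langle\alpha,x\rangle<j\}$. A non-folded alcove walk is a formal product $c_{i_1}^{\varepsilon_1}\cdots c_{i_n}^{\varepsilon_n}t_\sigma$ with $i_\nu\in\{0,\dots,r\}$, $\sigma\in\Omega$, where for each $\nu$, with $x_\nu=s_{i_1}\cdots s_{i_{\nu-1}}$, the sign $\varepsilon_\nu$ is $+$ if $x_\nu\mathbf a$ is on the negative side of its wall of type $i_\nu$ and $-$ if it is on the positive side. Its end point is $s_{i_1}\cdots s_{i_n}\sigma\in\widetilde W$. The map $\Phi$ sends $c_i^+\mapsto\tilde T_i$, $c_i^-\mapsto\tilde T_i^{-1}$, $t_\sigma\mapsto T_\sigma$, multiplicatively, with values in $\mathcal H$. The image under $\Phi$ of a non-folded alcove walk depends only on its end point. For $w\in W$, $t_w:=\Phi(p)^{-1}\in\mathcal H$, where $p$ is a non-folded alcove walk with end point $w^{-1}$ (a walk from $\mathbf a$ to $w^{-1}\mathbf a$). For $\lambda\in X_*$, $\theta_\lambda:=\Phi(p)\in\mathcal H$, where $p$ is a non-folded alcove walk with end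 point $\epsilon^\lambda$. The fraction in (3) is understood as the usual finite sum: with $n=\langle\alpha_i,\lambda\rangle$, it is $\sum_{m=0}^{n-1}\theta_{\lambda-m\alpha_i^\vee}$ if $n\ge0$ and $-\sum_{m=1}^{-n}\theta_{\lambda+m\alpha_i^\vee}$ if $n<0$. *)

(* Defs.v *)
From HB Require Import structures.
From mathcomp Require Import all_boot all_order all_algebra.
From mathcomp Require Import generic_quotient ring_quotient finmap.
From mathcomp Require Import all_classical all_reals all_analysis.

Set Implicit Arguments.
Unset Strict Implicit.
Unset Printing Implicit Defensive.

Import Order.TTheory GRing.Theory Num.Theory numFieldNormedType.Exports.

Local Open Scope classical_set_scope.
Local Open Scope ring_scope.
Local Open Scope quotient_scope.

Definition inverse_of (A : pzRingType) (x : A) : set A :=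
  [set y | x * y = 1 /\ y * x = 1].

Definition invertible (A : pzRingType) (x : A) : Prop :=
  exists y, inverse_of x y.

(* [rinv x] is the two-sided inverse of [x] when [x] is invertible, and 0
   otherwise; [GRing.inv] is unavailable because the Hecke algebra is only
   known to be a [pzRingType]. *)
Definition rinv (A : pzRingType) (x : A) : A := xget 0 (inverse_of x).

(* The letter [(x, true)] stands for the generator [x] and [(x, false)] for
   its inverse. *)
Definition word (X : Type) := seq (X * bool).

Inductive pres_eq (X : Type) (rels : word X -> word X -> Prop) :
    word X -> word X -> Prop :=
| pres_rel u u' of rels u u' : pres_eq rels u u'
| pres_cancel x b : pres_eq rels [:: (x, b); (x, ~~ b)] [::]
| pres_refl u : pres_eq rels u u
| pres_sym u u' of pres_eq rels u u' : pres_eq rels u' u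
| pres_trans u u' u'' of pres_eq rels u u' & pres_eq rels u' u'' :
    pres_eq rels u u''
| pres_cat u u' w w' of pres_eq rels u u' & pres_eq rels w w' :
    pres_eq rels (u ++ w) (u' ++ w').

Section PresentedGroup.
Variables (X : choiceType) (rels : word X -> word X -> Prop).

Let eqb (u w : word X) : bool := `[< pres_eq rels u w >].

Lemma pres_equiv : equiv_class_of eqb.
Proof.
split=> [u|u w|w u t]; rewrite /eqb.
- by apply/asboolP; exact: pres_refl.
- by apply/asboolP/asboolP; exact: pres_sym.
- by move=> /asboolP uw /asboolP wt; apply/asboolP; exact: pres_trans wt.
Qed.

Canonical pres_equivRel := EquivRelPack pres_equiv.
Canonical pres_encModRel := defaultEncModRel eqb.

Definition pres_group := {eq_quot eqb}.

HB.instance Definition _ : EqQuotient (word X) eqb pres_group :=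
  EqQuotient.on pres_group.
HB.instance Definition _ := Choice.on pres_group.

Definition pres_pi (u : word X) : pres_group := \pi_pres_group u.

Definition pres_gen (x : X) : pres_group := pres_pi [:: (x, true)].

Lemma pres_piP u w : pres_pi u = pres_pi w <-> pres_eq rels u w.
Proof.
split=> [/eqP|h]; first by rewrite piE => /asboolP.
by apply/eqP; rewrite piE; apply/asboolP.
Qed.

Lemma pres_reprP u : pres_eq rels (repr (pres_pi u)) u.
Proof. by apply/pres_piP; rewrite /pres_pi reprK. Qed.

Definition word_inv (u : word X) : word X :=
  rev [seq (l.1, ~~ l.2) | l <- u].

Definition pres_one : pres_group := pres_pi [::].
Definition pres_mul (g h : pres_group) : pres_group :=
  pres_pi (repr g ++ repr h).
Definition pres_inv (g : pres_group) : pres_group :=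
  pres_pi (word_inv (repr g)).

Lemma word_invK : involutive word_inv.
Proof.
move=> u; rewrite /word_inv map_rev revK -map_comp -[RHS]map_id.
by apply: eq_map => -[x b] /=; rewrite negbK.
Qed.

Lemma word_invr u : pres_eq rels (u ++ word_inv u) [::].
Proof.
elim: u => [|[x b] u IHu]; first exact: pres_refl.
have -> : word_inv ((x, b) :: u) = word_inv u ++ [:: (x, ~~ b)].
  by rewrite /word_inv /= rev_cons -cats1.
rewrite -cat1s -catA [u ++ _]catA.
apply: pres_trans (pres_cancel rels x b).
rewrite -(cat1s (x, b) [:: (x, ~~ b)]).
apply: pres_cat; first exact: pres_refl.
rewrite -[X in pres_eq _ _ X]cat0s.
by apply: pres_cat; [exact: IHu | exact: pres_refl].
Qed.

Lemma word_invl u : pres_eq rels (word_inv u ++ u) [::].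
Proof. by rewrite -{2}[u]word_invK; exact: word_invr. Qed.

Lemma pres_piM u w : pres_mul (pres_pi u) (pres_pi w) = pres_pi (u ++ w).
Proof. by apply/pres_piP; apply: pres_cat; exact: pres_reprP. Qed.

Lemma pres_mulA : associative pres_mul.
Proof.
move=> g h l; rewrite -[g]reprK -[h]reprK -[l]reprK.
by rewrite -/(pres_pi _) -/(pres_pi _) -/(pres_pi _) !pres_piM catA.
Qed.

Lemma pres_mul1 : left_id pres_one pres_mul.
Proof. by move=> g; rewrite -[g]reprK -/(pres_pi _) pres_piM. Qed.

Lemma pres_mulr1 : right_id pres_one pres_mul.
Proof. by move=> g; rewrite -[g]reprK -/(pres_pi _) pres_piM cats0. Qed.

Lemma pres_mulV : left_inverse pres_one pres_inv pres_mul.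
Proof.
move=> g; rewrite -{2}[g]reprK -/(pres_pi _) pres_piM.
by apply/pres_piP; exact: word_invl.
Qed.

Lemma pres_mulrV : right_inverse pres_one pres_inv pres_mul.
Proof.
move=> g; rewrite -{1}[g]reprK -/(pres_pi _) pres_piM.
by apply/pres_piP; exact: word_invr.
Qed.

HB.instance Definition _ := isGroup.Build pres_group
  pres_mulA pres_mul1 pres_mulr1 pres_mulV pres_mulrV.

End PresentedGroup.

Section GroupAlgebra.
Variables (k : comPzRingType) (G : groupType).

Definition finsupp_pred : {pred G -> k^o} :=
  [pred f : G -> k^o | `[< finite_set [set x | f x != 0] >]].

Lemma finsupp_closed : submod_closed finsupp_pred.
Proof.
split=> [|a f g].
  rewrite inE.
  have -> : [set x | (0 : G -> k^o) x != 0] = set0.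
    by apply/seteqP; split=> x //=; rewrite eqxx.
  exact: finite_set0.
rewrite !inE => fF gF.
have : finite_set ([set x | f x != 0] `|` [set x | g x != 0]).
  by rewrite finite_setU.
apply: sub_finite_set => x /=.
rewrite !fctE /=; have [->|fx _] := eqVneq (f x) 0; last by left.
by rewrite scaler0 add0r; right.
Qed.

HB.instance Definition _ :=
  GRing.isSubmodClosed.Build k (G -> k^o) finsupp_pred finsupp_closed.

Record galg := GAlg { galg_val :> G -> k^o; _ : galg_val \in finsupp_pred }.

HB.instance Definition _ := [isSub for galg_val].
HB.instance Definition _ := [Choice of galg by <:].
HB.instance Definition _ := [SubChoice_isSubLmodule of galg by <:].


Lemma galg_finite (f : galg) : finite_set [set x | f x != 0].
Proof. by case: f => f /= hf; move: (hf); rewrite inE. Qed.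

Definition galg_fun (f : G -> k) (hf : finite_set [set x | f x != 0]) : galg :=
  GAlg (asboolT hf : f \in finsupp_pred).

Lemma galg_ext (f g : galg) : (forall x, f x = g x) -> f = g.
Proof. by move=> h; apply: val_inj; apply: funext. Qed.

Lemma galgD (f g : galg) x : (f + g) x = f x + g x :> k.
Proof. by []. Qed.

Lemma galgZ (a : k) (f : galg) x : (a *: f) x = a * f x.
Proof. by []. Qed.

Definition galg_conv (f g : G -> k) (x : G) : k :=
  \sum_(y \in [set: G]) f y * g (y^-1 * x)%g.

Lemma galg_convE (A : {fset G}) (f g : G -> k) x :
    (forall y, y \notin A -> f y = 0) ->
  galg_conv f g x = \sum_(y <- A) f y * g (y^-1 * x)%g.
Proof. by move=> hA; apply: fsbigTE => y /hA ->; rewrite mul0r. Qed.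

Definition galg_supp (f : galg) : {fset G} := fset_set [set x | f x != 0].

Lemma galg_suppP (f : galg) y : y \notin galg_supp f -> f y = 0.
Proof.
rewrite in_fset_set; last exact: galg_finite.
by rewrite notin_setE /= => /negP; rewrite negbK => /eqP.
Qed.

Lemma galg_conv_supp (f g : galg) x :
  x \notin [fset (y * z)%g | y in galg_supp f, z in galg_supp g]%fset ->
  galg_conv f g x = 0.
Proof.
move=> hx; rewrite (galg_convE _ _ (@galg_suppP f)) big_seq big1 // => y yf.
rewrite (@galg_suppP g) ?mulr0 //; apply: contra hx => hz.
by apply/imfset2P; exists y => //; exists (y^-1 * x)%g; rewrite ?mulVKg.
Qed.

Lemma galg_conv_finite (f g : galg) : finite_set [set x | galg_conv f g x != 0].
Proof.
apply: (@sub_finite_set _ _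
  [set` [fset (y * z)%g | y in galg_supp f, z in galg_supp g]%fset]).
  by move=> x /=; apply: contraR => /galg_conv_supp ->.
exact: finite_fset.
Qed.

Definition galg_mul (f g : galg) : galg := galg_fun (galg_conv_finite f g).

Lemma delta_finite (g : G) :
  finite_set [set x : G | (x == g)%:R != 0 :> k].
Proof.
apply: (@sub_finite_set _ _ [set g]); last exact: finite_set1.
by move=> x /=; have [->|] := eqVneq x g; rewrite ?eqxx.
Qed.

Definition galg_delta (g : G) : galg := galg_fun (delta_finite g).

Lemma galg_mulA : associative galg_mul.
Proof.
move=> f g h; apply: galg_ext => x /=.
pose C := [fset (y * z)%g | y in galg_supp f, z in galg_supp g]%fset.
rewrite (galg_convE _ _ (@galg_suppP f)) (galg_convE (A := C)).
  2: by move=> y; exact: galg_conv_supp.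
under [RHS]eq_bigr => z _ do rewrite (galg_convE _ _ (@galg_suppP f)) mulr_suml.
rewrite exchange_big /= !big_seq; apply: eq_bigr => y yf.
under [RHS]eq_bigr => z _ do rewrite -mulrA.
rewrite -mulr_sumr; congr (_ * _).
rewrite -(fsbigTE C (fun z => g (y^-1 * z)%g * h (z^-1 * x)%g)); last first.
  move=> z hz; rewrite (@galg_suppP g) ?mul0r //; apply: contra hz => hz.
  by apply/imfset2P; exists y => //; exists (y^-1 * z)%g; rewrite ?mulVKg.
rewrite (reindex_fsbigT (fun u => (y * u)%g)); last first.
  by exists (fun u => (y^-1 * u)%g) => u; rewrite ?mulKg ?mulVKg.
by apply: eq_fsbigr => u _; rewrite mulKg invgM mulgA.
Qed.

Lemma galg_mul1 : left_id (galg_delta 1%g) galg_mul.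
Proof.
move=> f; apply: galg_ext => x /=.
rewrite (galg_convE (A := [fset 1%g]%fset)) ?big_seq_fset1 /=.
  by rewrite eqxx mul1r invg1 mul1g.
by move=> y; rewrite inE => /negPf ->.
Qed.

Lemma galg_mulr1 : right_id (galg_delta 1%g) galg_mul.
Proof.
move=> f; apply: galg_ext => x /=.
rewrite (galg_convE (A := (x |` galg_supp f)%fset)); last first.
  by move=> y; rewrite !inE negb_or => /andP[_ /galg_suppP].
rewrite (big_fsetD1 x) ?fset1U1 //= mulVg eqxx mulr1 big_seq big1 ?addr0 //.
move=> y; rewrite !inE => /andP[/negPf yx _].
by rewrite -(can_eq (mulKg y)) mulVKg mulg1 eq_sym yx mulr0.
Qed.

Lemma galg_mulDl : left_distributive galg_mul +%R.
Proof.
move=> f g h; apply: galg_ext => x; rewrite -[LHS]/(galg_conv (f + g)%R h x).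
pose C := (galg_supp f `|` galg_supp g)%fset.
have fC y : y \notin C -> f y = 0.
  by rewrite inE negb_or => /andP[/galg_suppP].
have gC y : y \notin C -> g y = 0.
  by rewrite inE negb_or => /andP[_ /galg_suppP].
rewrite -[RHS]/(galg_conv f h x + galg_conv g h x) (galg_convE _ _ fC).
rewrite (galg_convE _ _ gC) (galg_convE (A := C)) -?big_split.
  by apply: eq_bigr => y _; rewrite galgD mulrDl.
by move=> y yC; rewrite galgD fC // gC // addr0.
Qed.

Lemma galg_mulDr : right_distributive galg_mul +%R.
Proof.
move=> f g h; apply: galg_ext => x; rewrite -[LHS]/(galg_conv f (g + h)%R x).
rewrite -[RHS]/(galg_conv f g x + galg_conv f h x)
  !(galg_convE _ _ (@galg_suppP f)) -big_split.
by apply: eq_bigr => y _; rewrite galgD mulrDr.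
Qed.

HB.instance Definition _ := GRing.Zmodule_isPzRing.Build galg
  galg_mulA galg_mul1 galg_mulr1 galg_mulDl galg_mulDr.

Lemma galg_scalerAl (a : k) (f g : galg) : a *: (f * g) = (a *: f) * g.
Proof.
apply: galg_ext => x; rewrite -[RHS]/(galg_conv (a *: f)%R g x).
rewrite -[LHS]/(a * galg_conv f g x) (galg_convE _ _ (@galg_suppP f)).
rewrite (galg_convE (A := galg_supp f)) ?mulr_sumr.
  by apply: eq_bigr => y _; rewrite galgZ mulrA.
by move=> y /galg_suppP fy; rewrite galgZ fy mulr0.
Qed.

End GroupAlgebra.

Inductive ideal_gen (A : pzRingType) (S : set A) : A -> Prop :=
| ideal_gen0 : ideal_gen S 0
| ideal_genD a s b x of S s & ideal_gen S x : ideal_gen S (a * s * b + x).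

Section IdealQuotient.
Variables (k : comPzRingType) (G : groupType) (S : set (galg k G)).
Local Notation A := (galg k G).
Implicit Types x y : A.

Definition idealp : {pred A} := [pred x | `[< ideal_gen S x >]].

Lemma idealpP x : x \in idealp <-> ideal_gen S x.
Proof. by rewrite inE. Qed.

Lemma idealD x y : ideal_gen S x -> ideal_gen S y -> ideal_gen S (x + y).
Proof.
elim=> [|a s b z Ss _ IH] hy; first by rewrite add0r.
by rewrite -addrA; apply: ideal_genD => //; exact: IH.
Qed.

Lemma idealMl x y : ideal_gen S x -> ideal_gen S (y * x).
Proof.
elim=> [|a s b z Ss _ IH]; first by rewrite mulr0; exact: ideal_gen0.
by rewrite mulrDr !mulrA; exact: ideal_genD.
Qed.

Lemma idealMr x y : ideal_gen S x -> ideal_gen S (x * y).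
Proof.
elim=> [|a s b z Ss _ IH]; first by rewrite mul0r; exact: ideal_gen0.
by rewrite mulrDl -!mulrA mulrA; exact: ideal_genD.
Qed.

Lemma idealp_closed : zmod_closed idealp.
Proof.
split=> [|x y]; first by apply/idealpP; exact: ideal_gen0.
move=> /idealpP hx /idealpP hy; apply/idealpP; apply: idealD => //.
by rewrite -mulN1r; exact: idealMl.
Qed.

HB.instance Definition _ := GRing.isZmodClosed.Build A idealp idealp_closed.

Definition quot_alg := Quotient.quot idealp.

HB.instance Definition _ := GRing.Zmodule.on quot_alg.

Definition quot_pi (x : A) : quot_alg := \pi_quot_alg x.

Lemma quot_piP x y : quot_pi x = quot_pi y <-> ideal_gen S (x - y).
Proof.
rewrite -idealpP (Quotient.idealrBE idealp); split=> [/eqP //|/eqP //].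
Qed.

Lemma quot_reprK (u : quot_alg) : quot_pi (repr u) = u.
Proof. exact: reprK. Qed.

Lemma quot_piD x y : quot_pi (x + y) = quot_pi x + quot_pi y.
Proof. by rewrite /quot_pi !piE. Qed.

Definition quot_one : quot_alg := quot_pi 1.
Definition quot_mul (u t : quot_alg) : quot_alg := quot_pi (repr u * repr t).
Definition quot_scale (a : k) (u : quot_alg) : quot_alg :=
  quot_pi (a *: repr u).

Lemma quot_piM x y : quot_mul (quot_pi x) (quot_pi y) = quot_pi (x * y).
Proof.
apply/quot_piP; set x' := repr _; set y' := repr _.
have hx : ideal_gen S (x' - x) by apply/quot_piP; exact: reprK.
have hy : ideal_gen S (y' - y) by apply/quot_piP; exact: reprK.
have -> : x' * y' - x * y = (x' - x) * y' + x * (y' - y).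
  by rewrite mulrBl mulrBr addrA subrK.
by apply: idealD; [exact: idealMr | exact: idealMl].
Qed.

Lemma quot_piZ a x : quot_scale a (quot_pi x) = quot_pi (a *: x).
Proof.
apply/quot_piP; rewrite -scalerBr -[X in a *: X]mul1r galg_scalerAl.
by apply: idealMl; apply/quot_piP; exact: reprK.
Qed.

Lemma quot_mulA : associative quot_mul.
Proof.
by move=> x y z; rewrite -[x]quot_reprK -[y]quot_reprK -[z]quot_reprK
  !quot_piM mulrA.
Qed.

Lemma quot_mul1 : left_id quot_one quot_mul.
Proof. by move=> x; rewrite -[x]quot_reprK quot_piM mul1r. Qed.

Lemma quot_mulr1 : right_id quot_one quot_mul.
Proof. by move=> x; rewrite -[x]quot_reprK quot_piM mulr1. Qed.

Lemma quot_mulDl : left_distributive quot_mul +%R.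
Proof.
move=> x y z; rewrite -[x]quot_reprK -[y]quot_reprK -[z]quot_reprK.
by rewrite -quot_piD !quot_piM -quot_piD mulrDl.
Qed.

Lemma quot_mulDr : right_distributive quot_mul +%R.
Proof.
move=> x y z; rewrite -[x]quot_reprK -[y]quot_reprK -[z]quot_reprK.
by rewrite -quot_piD !quot_piM -quot_piD mulrDr.
Qed.

HB.instance Definition _ := GRing.Zmodule_isPzRing.Build quot_alg
  quot_mulA quot_mul1 quot_mulr1 quot_mulDl quot_mulDr.

Lemma quot_scaleA a b u :
  quot_scale a (quot_scale b u) = quot_scale (a * b) u.
Proof. by rewrite -[u]quot_reprK !quot_piZ scalerA. Qed.

Lemma quot_scale1 : left_id 1 quot_scale.
Proof. by move=> u; rewrite -[u]quot_reprK quot_piZ scale1r. Qed.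

Lemma quot_scaleDr : right_distributive quot_scale +%R.
Proof.
move=> a u t; rewrite -[u]quot_reprK -[t]quot_reprK.
by rewrite -quot_piD !quot_piZ -quot_piD scalerDr.
Qed.

Lemma quot_scaleDl u : {morph quot_scale^~ u : a b / a + b}.
Proof.
by move=> a b; rewrite -[u]quot_reprK !quot_piZ -quot_piD scalerDl.
Qed.

HB.instance Definition _ := GRing.Zmodule_isLmodule.Build k quot_alg
  quot_scaleA quot_scale1 quot_scaleDr quot_scaleDl.

End IdealQuotient.

(* [chars] is X^*, [cochars] is X_*.  The families [chbasis] and [cobasis]
   are dual bases; they witness that the pairing is a perfect duality of free
   abelian groups of finite rank.  The map [coroot] is only meaningful on
   [roots], and the set of coroots is the image of [roots]. *)
Record based_root_datum := BasedRootDatum {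
  chars : zmodType;
  cochars : zmodType;
  pairing : chars -> cochars -> int;
  pairingDl : forall x y l, pairing (x + y) l = pairing x l + pairing y l;
  pairingDr : forall x l m, pairing x (l + m) = pairing x l + pairing x m;
  rk : nat;
  chbasis : 'I_rk -> chars;
  cobasis : 'I_rk -> cochars;
  pairing_basis : forall i j, pairing (chbasis i) (cobasis j) = (i == j)%:R;
  chbasis_span :
    forall x, x = \sum_i chbasis i *~ pairing x (cobasis i);
  cobasis_span :
    forall l, l = \sum_i cobasis i *~ pairing (chbasis i) l;
  roots : seq chars;
  roots_uniq : uniq roots;
  coroot : chars -> cochars;
  coroot_inj : {in roots &, injective coroot};
  pairing_coroot : {in roots, forall a, pairing a (coroot a) = 2};
  refl_roots :
    {in roots &, forall a b, b - a *~ pairing b (coroot a) \in roots};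
  refl_coroots :
    {in roots &, forall a b, coroot b - coroot a *~ pairing a (coroot b)
                               \in [seq coroot c | c <- roots]};
  ssrk : nat;
  simple : 'I_ssrk -> chars;
  simple_root : forall i, simple i \in roots;
  simple_free : forall c : 'I_ssrk -> int,
    \sum_i simple i *~ c i = 0 -> forall i, c i = 0;
  simple_base : {in roots, forall a, exists c : 'I_ssrk -> nat,
    a = \sum_i simple i *+ c i \/ a = - \sum_i simple i *+ c i}
}.

Definition reduced (D : based_root_datum) : Prop :=
  forall (a b : chars D) (m n : int), a \in roots D -> b \in roots D ->
    m != 0 -> b *~ m = a *~ n -> b = a \/ b = - a.

Definition irreducible (D : based_root_datum) : Prop :=
  roots D != [::] /\
  forall P : {pred chars D},
    {in roots D &, forall a b, a \in P -> b \notin P ->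
       pairing a (coroot b) = 0} ->
    {in roots D, forall a, a \in P} \/ {in roots D, forall a, a \notin P}.

Section RootDatum.
Variable D : based_root_datum.
Local Notation r := (ssrk D).
Implicit Types (a b x : chars D) (l : cochars D).

(* In X^*, [dominates a b] says that [a - b] is a sum of simple roots. *)
Definition dominates a b : Prop :=
  exists c : 'I_r -> nat, a - b = \sum_i simple i *+ c i.

Definition posroot a : bool := (a \in roots D) && `[< dominates a 0 >].

Definition highest_root : chars D :=
  xget 0 [set a | a \in roots D /\ {in roots D, forall b, dominates a b}].

Definition corefl a l : cochars D := l - coroot a *~ pairing a l.

Inductive weyl_fun : (cochars D -> cochars D) -> Prop :=
| weyl_id : weyl_fun id
| weyl_step i w of weyl_fun w : weyl_fun (corefl (simple i) \o w).

Record weyl := Weyl { weyl_val :> cochars D -> cochars D;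
                      _ : `[< weyl_fun weyl_val >] }.

HB.instance Definition _ := [isSub for weyl_val].
HB.instance Definition _ := [Choice of weyl by <:].

Lemma weylP (w : weyl) : weyl_fun w.
Proof. by case: w => w /= /asboolP. Qed.

Lemma weyl_ext (w w' : weyl) : (forall l, w l = w' l) -> w = w'.
Proof. by move=> h; apply: val_inj; apply: funext. Qed.

Lemma weyl_fun_comp w w' : weyl_fun w -> weyl_fun w' -> weyl_fun (w \o w').
Proof.
move=> hw hw'; elim: hw => [|i u _ IH] //.
exact: (weyl_step i IH).
Qed.

Lemma pairing0r x : pairing x 0 = 0.
Proof. by apply: (addrI (pairing x 0)); rewrite -pairingDr !addr0. Qed.

Lemma pairingNr x l : pairing x (- l) = - pairing x l.
Proof.
by apply: (addrI (pairing x l)); rewrite -pairingDr !subrr pairing0r.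
Qed.

Lemma pairingMnr x l n : pairing x (l *+ n) = pairing x l *+ n.
Proof.
by elim: n => [|n IH]; rewrite ?pairing0r // !mulrS pairingDr IH.
Qed.

Lemma pairingMzr x l (n : int) : pairing x (l *~ n) = pairing x l * n.
Proof.
case: n => n; rewrite ?NegzE ?mulrNz ?pairingNr ?mulrN -?pmulrn pairingMnr.
  by rewrite -mulr_natr natz.
by rewrite -mulr_natr natz.
Qed.

Lemma coreflK a : a \in roots D -> involutive (corefl a).
Proof.
move=> ha l; set p := pairing a l.
have hp : pairing a (corefl a l) = - p.
  rewrite pairingDr pairingNr pairingMzr pairing_coroot // -/p.
  by rewrite mulr_natl mulr2n opprD addrA subrr add0r.
by rewrite [LHS]/corefl hp mulrNz opprK subrK.
Qed.

Lemma weyl_fun_inv w : weyl_fun w ->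
  exists w', [/\ weyl_fun w', w' \o w = id & w \o w' = id].
Proof.
elim=> [|i u hu [u' [hu' u'u uu']]]; first by exists id; split=> //;
  exact: weyl_id.
have sK := coreflK (simple_root i).
exists (u' \o (corefl (simple i) \o id)); split.
- by apply: weyl_fun_comp => //; apply: weyl_step; exact: weyl_id.
- by apply: funext => l /=; rewrite sK; exact: (congr1 (@^~ l) u'u).
- by apply: funext => l /=; rewrite (congr1 (@^~ _) uu' : u (u' _) = _) sK.
Qed.

Definition weyl_one : weyl := Weyl (asboolT weyl_id).
Definition weyl_mul (w w' : weyl) : weyl :=
  Weyl (asboolT (weyl_fun_comp (weylP w) (weylP w'))).
Definition weyl_inv (w : weyl) : weyl :=
  let: exist _ h := cid (weyl_fun_inv (weylP w)) in
  Weyl (asboolT (let: And3 h1 _ _ := h in h1)).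

Lemma weyl_mulA : associative weyl_mul.
Proof. by move=> u v w; apply: weyl_ext. Qed.

Lemma weyl_mul1 : left_id weyl_one weyl_mul.
Proof. by move=> w; apply: weyl_ext. Qed.

Lemma weyl_mulr1 : right_id weyl_one weyl_mul.
Proof. by move=> w; apply: weyl_ext. Qed.

Lemma weyl_mulV : left_inverse weyl_one weyl_inv weyl_mul.
Proof.
move=> w; apply: weyl_ext => l; rewrite /weyl_inv /=.
by case: cid => w' [h1 h2 h3] /=; exact: (congr1 (@^~ l) h2).
Qed.

Lemma weyl_mulrV : right_inverse weyl_one weyl_inv weyl_mul.
Proof.
move=> w; apply: weyl_ext => l; rewrite /weyl_inv /=.
by case: cid => w' [h1 h2 h3] /=; exact: (congr1 (@^~ l) h3).
Qed.

HB.instance Definition _ := isGroup.Build weyl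
  weyl_mulA weyl_mul1 weyl_mulr1 weyl_mulV weyl_mulrV.

Definition srefl (i : 'I_r) : weyl := Weyl (asboolT (weyl_step i weyl_id)).

(* The reflection in a root, as an element of the Weyl group; the default
   value 1 is never taken for a root. *)
Definition refl a : weyl := insubd (1%g : weyl) (corefl a).

(* The contragredient action, characterised by <w x, w l> = <x, l>. *)
Definition weyl_char (w : weyl) x : chars D :=
  \sum_i chbasis i *~ pairing x ((w^-1)%g (cobasis i)).

(* The pair [(l, w)] stands for [eps^l w], i.e. [y |-> l + w y]. *)
Definition ext_weyl := (cochars D * weyl)%type.

HB.instance Definition _ := Choice.on ext_weyl.

Implicit Types g h : ext_weyl.

Definition ext_one : ext_weyl := (0, 1%g).
Definition ext_mul g h : ext_weyl := (g.1 + g.2 h.1, (g.2 * h.2)%g).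
Definition ext_inv g : ext_weyl := (- (g.2^-1)%g g.1, (g.2^-1)%g).

Lemma corefl_additive a l m : corefl a (l + m) = corefl a l + corefl a m.
Proof. by rewrite /corefl pairingDr mulrzDr opprD addrACA. Qed.

Lemma weylD (w : weyl) l m : w (l + m) = w l + w m.
Proof.
case: w => w /= /asboolP hw; elim: hw l m => // i u _ IH l m /=.
by rewrite IH corefl_additive.
Qed.

Lemma weyl0 (w : weyl) : w 0 = 0.
Proof. by apply: (addrI (w 0)); rewrite -weylD !addr0. Qed.

Lemma weylN (w : weyl) l : w (- l) = - w l.
Proof. by apply: (addrI (w l)); rewrite -weylD !subrr weyl0. Qed.

Lemma weylM (w w' : weyl) l : (w * w')%g l = w (w' l).
Proof. by []. Qed.

Lemma weyl1 l : (1%g : weyl) l = l.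
Proof. by []. Qed.

Lemma ext_mulA : associative ext_mul.
Proof.
by move=> f g h; rewrite /ext_mul /= weylD addrA mulgA.
Qed.

Lemma ext_mul1 : left_id ext_one ext_mul.
Proof. by case=> l w; rewrite /ext_mul /= add0r mul1g. Qed.

Lemma ext_mulr1 : right_id ext_one ext_mul.
Proof. by case=> l w; rewrite /ext_mul /= weyl0 addr0 mulg1. Qed.

Lemma ext_mulV : left_inverse ext_one ext_inv ext_mul.
Proof. by case=> l w; rewrite /ext_mul /= addNr mulVg. Qed.

Lemma ext_mulrV : right_inverse ext_one ext_inv ext_mul.
Proof.
case=> l w; rewrite /ext_mul /= mulgV weylN.
by rewrite -[w _]/((w * w^-1)%g l) mulgV subrr.
Qed.

HB.instance Definition _ := isGroup.Build ext_weyl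
  ext_mulA ext_mul1 ext_mulr1 ext_mulV ext_mulrV.

Definition transl l : ext_weyl := (l, 1%g).
Definition of_weyl (w : weyl) : ext_weyl := (0, w).

(* Index 0 is the affine simple reflection, index i > 0 the i-th simple
   reflection of the finite Weyl group. *)
Definition arefl (i : 'I_r.+1) : ext_weyl :=
  if unlift ord0 i is Some j then of_weyl (srefl j)
  else (transl (coroot highest_root) * of_weyl (refl highest_root))%g.

(* The length of [w eps^l], where [g = eps^(w l) w = w eps^l]. *)
Definition elen g : nat :=
  let w := g.2 in
  let l := (w^-1)%g g.1 in
  (\sum_(a <- roots D | posroot a && posroot (- weyl_char w a))
      `|(pairing a l + 1)%R| +
   \sum_(a <- roots D | posroot a && posroot (weyl_char w a))
      `|pairing a l|)%N.

Definition wlen (w : weyl) : nat := elen (of_weyl w).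

Definition longest (P : set weyl) (w : weyl) : Prop :=
  P w /\ forall u, P u -> (wlen u <= wlen w)%N.

Definition stabilizer l : set weyl := [set w | w l = l].

Definition braid_rel (u u' : word ext_weyl) : Prop :=
  exists g h, [/\ elen (g * h)%g = (elen g + elen h)%N,
    u = [:: (g, true); (h, true)] & u' = [:: ((g * h)%g, true)]].

Definition braid := pres_group braid_rel.

HB.instance Definition _ := Group.on braid.

Section Hecke.
Variables (k : comPzRingType) (q : k).

Definition braid_gen (g : ext_weyl) : galg k braid :=
  galg_delta k (pres_gen braid_rel g : braid).

Definition hecke_rel : set (galg k braid) :=
  [set x | exists i, x = (braid_gen (arefl i) + 1) *
                         (braid_gen (arefl i) - q *: (1 : galg k braid))].

Definition hecke := quot_alg hecke_rel.

HB.instance Definition _ := GRing.PzRing.on hecke.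
HB.instance Definition _ := GRing.Lmodule.on hecke.

Definition hT (g : ext_weyl) : hecke := quot_pi hecke_rel (braid_gen g).

End Hecke.

Definition nT (k : comPzRingType) (v : k) (g : ext_weyl) : hecke (v ^+ 2) :=
  rinv v ^+ elen g *: hT (v ^+ 2) g.

Section Alcoves.
Variable R : realType.

(* X_* tensored with R, in coordinates with respect to [cobasis D]. *)
Local Notation V := 'rV[R]_(rk D).
Implicit Types (y z : V) (A C H : set V).

Definition rpairing a y : R := \sum_i (pairing a (cobasis i))%:~R * y 0 i.

Definition rembed l : V := \row_i (pairing (chbasis i) l)%:~R.

Definition weyl_act (w : weyl) y : V :=
  \row_j \sum_i (pairing (chbasis j) (w (cobasis i)))%:~R * y 0 i.

Definition ext_act (g : ext_weyl) y : V := rembed g.1 + weyl_act g.2 y.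

Definition hyp a (n : int) : set V := [set y | rpairing a y = n%:~R].
Definition posside a (n : int) : set V := [set y | n%:~R < rpairing a y].
Definition negside a (n : int) : set V := [set y | rpairing a y < n%:~R].

Definition hyp_compl : set V :=
  [set y | forall a (n : int), a \in roots D -> ~ hyp a n y].

Definition alcove A : Prop :=
  exists2 y, hyp_compl y & A = connected_component hyp_compl y.

Definition dominant_chamber : set V :=
  [set y | forall a, posroot a -> 0 < rpairing a y].

Definition base_alcove : set V :=
  xget set0 [set A | [/\ alcove A, A `<=` dominant_chamber & closure A 0]].

(* [H] is a wall of [C]: it does not meet [C], and the closure of [C] contains
   a nonempty relatively open subset of [H]. *)
Definition is_wall C H : Prop :=
  C `&` H = set0 /\
  exists2 y, H y & exists2 U, nbhs y U & U `&` H `<=` closure C.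

Definition type_wall (i : 'I_r.+1) (g : ext_weyl) : set V :=
  ext_act g @` [set y | ext_act (arefl i) y = y].

(* The sign [true] stands for +, [false] for -. *)
Definition step_sign (i : 'I_r.+1) (g : ext_weyl) (e : bool) : Prop :=
  exists a (n : int), [/\ posroot a, type_wall i g = hyp a n &
    ext_act g @` base_alcove `<=` if e then negside a n else posside a n].

(* [steps_from g s]: the signs in [s] are correct for the sequence of
   steps [s] starting in the alcove [g a]. *)
Fixpoint steps_from (g : ext_weyl) (s : seq ('I_r.+1 * bool)) : Prop :=
  if s is (i, e) :: s' then step_sign i g e /\ steps_from (g * arefl i)%g s'
  else True.

Definition walk := (seq ('I_r.+1 * bool) * ext_weyl)%type.

Definition nonfolded (p : walk) : Prop :=
  steps_from 1%g p.1 /\ elen p.2 = 0%N.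

Definition endpoint (p : walk) : ext_weyl :=
  foldr (fun s g => (arefl s.1 * g)%g) p.2 p.1.

Section Phi.
Variables (k : comPzRingType) (v : k).
Local Notation H := (hecke (v ^+ 2)).

Definition Phi_step (s : 'I_r.+1 * bool) : H :=
  if s.2 then nT v (arefl s.1) else rinv (nT v (arefl s.1)).

Definition Phi (p : walk) : H :=
  (\prod_(s <- p.1) Phi_step s) * hT (v ^+ 2) p.2.

(* Some nonfolded walk with end point [g]; the image of such a walk under
   [Phi] does not depend on the choice. *)
Definition walk_to (g : ext_weyl) : walk :=
  xget ([::], 1%g) [set p | nonfolded p /\ endpoint p = g].

Definition theta l : H := Phi (walk_to (transl l)).

Definition tfin (w : weyl) : H := rinv (Phi (walk_to (of_weyl w^-1%g))).

(* The finite sum (theta_l - theta_(s_a l)) / (1 - theta_(-a^v)). *)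
Definition bernstein_frac a l : H :=
  match pairing a l with
  | Posz n => \sum_(0 <= m < n) theta (l - coroot a *+ m)
  | Negz n => - \sum_(1 <= m < n.+2) theta (l + coroot a *+ m)
  end.

End Phi.
End Alcoves.
End RootDatum.

Arguments base_alcove D R : clear implicits.
Arguments dominant_chamber D R : clear implicits.
Arguments theta {D} R {k} v l.
Arguments tfin {D} R {k} v w.
Arguments bernstein_frac {D} R {k} v a l.
Arguments hyp {D} R a n.
Arguments Phi_step {D k} v s.

(* Main.v *)
(** For an alcove walk [p] with end point [g] and a sufficiently dominant
    cocharacter [m], translation by [m] moves all alcoves of [p] deep into the
    dominant chamber, where a step increases the length exactly when its sign
    is [+]; hence [T~_(eps^m) Phi(p) = T~_(eps^m g)].  So [Phi(p)] depends only
    on [g], and (1), (2), (4), (5) become statements about lengths; in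
    particular [t_w = T~_w], and [theta_l = T~_(eps^l)] for dominant [l].

    For (3), let [h] have linear part [s_i].  Since [s_i] permutes the positive
    roots other than [alpha_i], a walk inside the strip [0 < alpha_i < 1] and
    its image under [h] have the same signs, so [Phi] is multiplicative on
    [h x] whenever the alcove of [x] lies in the strip.  With [h = s_i] this
    gives (3) for [<alpha_i, l>] equal to [0] or [1].  With [h] the reflection
    in the wall [<alpha_i, y> = 1] it shows that [Phi(h)] is conjugate to some
    [T~_j], so [Phi(h) = theta_(alpha_i^v) t_i^(-1)] satisfies the quadratic
    relation, which is (3) for [l = - alpha_i^v].  The general case follows by
    adding multiples of [alpha_i^v]. *)

From HB Require Import structures.
From mathcomp Require Import all_boot all_order all_algebra.
From mathcomp Require Import finmap.
From mathcomp Require Import all_classical all_reals all_analysis.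
From mathcomp Require Import ring lra zify.
Require Import Defs.

Set Implicit Arguments.
Unset Strict Implicit.
Unset Printing Implicit Defensive.

Import Order.TTheory GRing.Theory Num.Theory numFieldNormedType.Exports.
Local Open Scope ring_scope.

(** * Roots and coroots *)

(** For (3), the cases where [<alpha_i, l>] is 0 or 1 do not suffice: if [alpha_i] takes only even
    values on cocharacters, the value 1 never occurs. Crossing a wall [<alpha_i, y> = 1] supplies
    the missing relation. The type [j] of that wall depends on the alcove chosen next to it, and is
    left unspecified. Alcoves are encoded by the integers [offset g a], the integral part of [a] on
    the alcove of [g]. A step changes a single offset, up to sign of the root, by one. Real geometry
    enters only to attach signs to steps, to show that the base alcove exists, and to identify [phi]
    with the highest root. The axioms of a root datum say separately that reflections preserve roots
    and that they preserve coroots. The compatibility of the two, the highest root and the Coxeter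
    properties of the Weyl group are derived first. *)

Section Roots.
Variable D : based_root_datum.
Implicit Types (a b c x y : chars D) (l m : cochars D) (w u : weyl D).

Lemma pairing0l l : pairing (0 : chars D) l = 0.
Proof. by apply: (addrI (pairing 0 l)); rewrite -pairingDl !addr0. Qed.

Lemma pairingNl x l : pairing (- x) l = - pairing x l.
Proof.
by apply: (addrI (pairing x l)); rewrite -pairingDl !subrr pairing0l.
Qed.

Lemma pairingBl x y l : pairing (x - y) l = pairing x l - pairing y l.
Proof. by rewrite pairingDl pairingNl. Qed.

Lemma pairingBr x l m : pairing x (l - m) = pairing x l - pairing x m.
Proof. by rewrite pairingDr pairingNr. Qed.

Lemma pairingMnl x l n : pairing (x *+ n) l = pairing x l *+ n.
Proof.
by elim: n => [|n IH]; rewrite ?pairing0l // !mulrS pairingDl IH.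
Qed.

Lemma pairingMzl x l (n : int) : pairing (x *~ n) l = pairing x l * n.
Proof.
case: n => n; rewrite ?NegzE ?mulrNz ?pairingNl ?mulrN -?pmulrn pairingMnl.
  by rewrite -mulr_natr natz.
by rewrite -mulr_natr natz.
Qed.

Lemma pairing_suml I (r : seq I) P (F : I -> chars D) l :
  pairing (\sum_(i <- r | P i) F i) l = \sum_(i <- r | P i) pairing (F i) l.
Proof.
by rewrite (big_morph (fun x => pairing x l) (fun x y => @pairingDl D x y l) (pairing0l l)).
Qed.

Lemma pairing_sumr I (r : seq I) P (F : I -> cochars D) x :
  pairing x (\sum_(i <- r | P i) F i) = \sum_(i <- r | P i) pairing x (F i).
Proof. by rewrite (big_morph (pairing x) (@pairingDr D x) (pairing0r x)). Qed.

Lemma chars_ext x y : (forall l, pairing x l = pairing y l) -> x = y.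
Proof.
by move=> h; rewrite (chbasis_span x) (chbasis_span y); apply: eq_bigr => i _;
  rewrite h.
Qed.

Lemma cochars_ext l m : (forall x, pairing x l = pairing x m) -> l = m.
Proof.
by move=> h; rewrite (cobasis_span l) (cobasis_span m); apply: eq_bigr => i _;
  rewrite h.
Qed.

Lemma cochars_torsion_free l m (n : int) : n != 0 -> l *~ n = m *~ n -> l = m.
Proof.
move=> n0 h; apply: cochars_ext => x; apply: (mulIf n0).
by rewrite -!pairingMzr h.
Qed.

Definition charefl a x : chars D := x - a *~ pairing x (coroot a).

Lemma pairing_charefl a x l :
  pairing (charefl a x) l = pairing x (corefl a l).
Proof. by rewrite pairingBl pairingMzl pairingBr pairingMzr mulrC. Qed.

Lemma charefl_root a b : a \in roots D -> b \in roots D ->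
  charefl a b \in roots D.
Proof. exact: refl_roots. Qed.

Lemma charefl_self a : a \in roots D -> charefl a a = - a.
Proof.
move=> ha; rewrite /charefl pairing_coroot //.
by apply/eqP; rewrite subr_eq addrC -[2]/(1 + 1) mulrzDr !mulr1z addrK.
Qed.

Lemma opp_root a : a \in roots D -> - a \in roots D.
Proof. by move=> ha; rewrite -charefl_self ?charefl_root. Qed.

Lemma opp_rootE a : (- a \in roots D) = (a \in roots D).
Proof. by apply/idP/idP => /opp_root //; rewrite opprK. Qed.

Lemma root_neq0 a : a \in roots D -> a != 0.
Proof.
move=> ha; apply/eqP => a0; have := pairing_coroot ha.
by rewrite {1}a0 pairing0l.
Qed.

Lemma corefl0 a : corefl a 0 = 0.
Proof. by rewrite /corefl pairing0r mulr0z subrr. Qed.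

Lemma coreflMz a l (n : int) : corefl a (l *~ n) = corefl a l *~ n.
Proof. by rewrite /corefl pairingMzr mulrzBl mulrzA. Qed.

Lemma corefl_sum a I (r : seq I) P (F : I -> cochars D) :
  corefl a (\sum_(i <- r | P i) F i) = \sum_(i <- r | P i) corefl a (F i).
Proof. by rewrite (big_morph (corefl a) (corefl_additive a) (corefl0 a)). Qed.

(** The axiom [refl_coroots] does not tell which root the reflected coroot belongs to. Permuting the
    set of coroots is enough to make [coroot_form] equivariant, and [coroot_charefl] then recovers
    the root. *)
Lemma perm_coroots a : a \in roots D ->
  perm_eq [seq corefl a l | l <- [seq coroot b | b <- roots D]]
          [seq coroot b | b <- roots D].
Proof.
move=> ha; set C := [seq coroot b | b <- roots D].
have uC : uniq C by rewrite map_inj_in_uniq ?roots_uniq //; exact: coroot_inj.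
have uI : uniq [seq corefl a l | l <- C].
  by rewrite map_inj_uniq //; exact: can_inj (coreflK ha).
have sub : {subset [seq corefl a l | l <- C] <= C}.
  by move=> _ /mapP[_ /mapP[b hb ->] ->]; exact: refl_coroots.
have [|_ e] := uniq_min_size uI sub; first by rewrite !size_map.
exact: uniq_perm.
Qed.

(** The standard equivariant map from characters to cocharacters. Its form [qform] is positive
    semidefinite and positive on roots; it takes the place of an invariant inner product. *)
Definition coroot_form x : cochars D :=
  \sum_(c <- roots D) coroot c *~ pairing x (coroot c).

Lemma coroot_form_refl a x : a \in roots D ->
  coroot_form (charefl a x) = corefl a (coroot_form x).
Proof.
move=> ha; rewrite /coroot_form corefl_sum.
pose F l := l *~ pairing (charefl a x) l.
rewrite -[LHS](big_map (@coroot D) xpredT F) -(perm_big _ (perm_coroots ha)).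
rewrite big_map big_map; apply: eq_bigr => c _.
by rewrite /F pairing_charefl coreflK // coreflMz.
Qed.

Lemma coroot_formMz x (n : int) : coroot_form (x *~ n) = coroot_form x *~ n.
Proof.
by rewrite /coroot_form mulrz_suml; apply: eq_bigr => c _; rewrite pairingMzl mulrzA.
Qed.

Definition qform x y : int := pairing x (coroot_form y).

Lemma qformE x y : qform x y =
  \sum_(c <- roots D) pairing x (coroot c) * pairing y (coroot c).
Proof.
by rewrite /qform pairing_sumr; apply: eq_bigr => c _; rewrite pairingMzr.
Qed.

Lemma qformC x y : qform x y = qform y x.
Proof. by rewrite !qformE; apply: eq_bigr => c _; rewrite mulrC. Qed.

Lemma qform_ge0 x : 0 <= qform x x.
Proof. by rewrite qformE; apply: sumr_ge0 => c _; rewrite -expr2 sqr_ge0. Qed.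

Lemma qform_eq0 x c : qform x x = 0 -> c \in roots D -> pairing x (coroot c) = 0.
Proof.
move=> /eqP; rewrite qformE psumr_eq0 => [/allP h /h|e _].
  by rewrite mulf_eq0 orbb => /eqP.
by rewrite -expr2 sqr_ge0.
Qed.

Lemma qform_gt0 a : a \in roots D -> 0 < qform a a.
Proof.
move=> ha; rewrite lt_neqAle qform_ge0 andbT eq_sym; apply/eqP => h.
by have := qform_eq0 h ha; rewrite pairing_coroot.
Qed.

(** The reflection in [a] negates [a], hence also [coroot_form a]; writing this out gives the usual
    [a^v = 2 a / (a, a)]. *)
Lemma coroot_formE a : a \in roots D ->
  coroot_form a *~ 2 = coroot a *~ qform a a.
Proof.
move=> ha; have := coroot_form_refl a ha.
have -> : charefl a a = a *~ -1 by rewrite charefl_self // mulrNz mulr1z.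
rewrite coroot_formMz mulrNz mulr1z /corefl -/(qform a a) => /eqP.
rewrite eq_sym subr_eq addrC => /eqP h.
by rewrite -[2]/(1 + 1) mulrzDr mulr1z {1}h addrNK.
Qed.

Lemma qform_coroot a b : b \in roots D ->
  pairing a (coroot b) * qform b b = 2 * qform a b.
Proof.
by move=> hb; rewrite -pairingMzr -coroot_formE // pairingMzr mulrC.
Qed.

Lemma pairing_coroot_gt0 a b : a \in roots D -> b \in roots D ->
  (0 < pairing a (coroot b)) = (0 < pairing b (coroot a)).
Proof.
move=> ha hb; rewrite -(pmulr_lgt0 _ (qform_gt0 hb)) qform_coroot //.
by rewrite qformC -qform_coroot // pmulr_lgt0 ?qform_gt0.
Qed.

Lemma pairing_coroot_lt0 a b : a \in roots D -> b \in roots D ->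
  (pairing a (coroot b) < 0) = (pairing b (coroot a) < 0).
Proof.
move=> ha hb; rewrite -(pmulr_llt0 _ (qform_gt0 hb)) qform_coroot //.
by rewrite qformC -qform_coroot // pmulr_llt0 ?qform_gt0.
Qed.

Lemma pairing_coroot_eq0 a b : a \in roots D -> b \in roots D ->
  (pairing a (coroot b) == 0) = (pairing b (coroot a) == 0).
Proof.
by move=> ha hb; rewrite !eq_le !leNgt pairing_coroot_gt0 // pairing_coroot_lt0.
Qed.

(* By Cauchy-Schwarz the product of the two Cartan integers is at most 4. *)
Lemma eq_root_pairing_ge2 a b : a \in roots D -> b \in roots D ->
  2 <= pairing a (coroot b) -> 2 <= pairing b (coroot a) -> a = b.
Proof.
move=> ha hb; have := qform_coroot a hb; have := qform_coroot b ha.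
rewrite [qform b a]qformC.
set A := qform a a; set B := qform b b; set C := qform a b.
have A0 : 0 < A by exact: qform_gt0.
have B0 : 0 < B by exact: qform_gt0.
have qD x y z (n n' : int) :
  qform (x *~ n - y *~ n') z = qform x z * n - qform y z * n'.
  by rewrite /qform pairingBl !pairingMzl.
have CS : 0 <= A * (A * B - C * C).
  have := qform_ge0 (b *~ A - a *~ C); rewrite qD.
  rewrite ![qform _ (b *~ A - _)]qformC !qD [qform b a]qformC -/A -/B -/C.
  by congr (0 <= _); ring.
move=> e1 e2 h1 h2; have hC : C * C <= A * B.
  by move: CS; rewrite pmulr_rge0 // subr_ge0.
(* The hypotheses give [A <= C] and [B <= C]; with [C * C <= A * B] this forces equality, so [b - a]
   has norm 0 and pairs to 0 with every coroot. *)
have [eA eB] : A = C /\ B = C by nia.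
have q0 : qform (b - a) (b - a) = 0.
  have -> : b - a = b *~ 1 - a *~ 1 by rewrite !mulr1z.
  rewrite qD ![qform _ (b *~ _ - _)]qformC !qD [qform b a]qformC -/A -/B -/C.
  by rewrite eA eB; ring.
have : coroot_form b = coroot_form a.
  apply: eq_big_seq => c hc; congr (_ *~ _).
  by apply/eqP; rewrite -subr_eq0 -pairingBl (qform_eq0 q0 hc).
move/(congr1 (fun l => l *~ 2)); rewrite !coroot_formE // -/A -/B eA eB => h.
apply: coroot_inj => //; apply/esym/(cochars_torsion_free _ h).
by rewrite gt_eqF // -eA.
Qed.

(** By [coroot_formE] and equivariance both sides agree after multiplication by [(b, b)], and
    cocharacters are torsion free. *)
Lemma coroot_charefl a b : a \in roots D -> b \in roots D ->
  coroot (charefl a b) = corefl a (coroot b).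
Proof.
move=> ha hb; have hc := charefl_root ha hb.
have q_eq : qform (charefl a b) (charefl a b) = qform b b.
  by rewrite /qform coroot_form_refl // pairing_charefl coreflK.
apply: (@cochars_torsion_free _ _ (qform b b)); first by rewrite gt_eqF ?qform_gt0.
rewrite -coreflMz -coroot_formE // coreflMz -coroot_form_refl //.
by rewrite -{1}q_eq -coroot_formE.
Qed.

Lemma corefl_coroot a : a \in roots D -> corefl a (coroot a) = - coroot a.
Proof.
move=> ha; rewrite /corefl pairing_coroot //.
by apply/eqP; rewrite subr_eq addrC -[2]/(1 + 1) mulrzDr !mulr1z addrK.
Qed.

Lemma corootN a : a \in roots D -> coroot (- a) = - coroot a.
Proof.
by move=> ha; rewrite -charefl_self // coroot_charefl // corefl_coroot.
Qed.

Lemma weyl_ind (P : weyl D -> Prop) :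
  P 1%g -> (forall i w, P w -> P (srefl i * w)%g) -> forall w, P w.
Proof.
move=> P1 PS w; have [f hf ef] : exists2 f, weyl_fun f & weyl_val w = f.
  by exists w => //; exact: weylP.
elim: f / hf w ef => [|i f hf IH] w ef.
  by rewrite (_ : w = 1%g) //; apply: weyl_ext => l; rewrite ef.
have -> : w = (srefl i * Weyl (asboolT hf))%g.
  by apply: weyl_ext => l; rewrite ef.
by apply: PS; exact: IH.
Qed.

Lemma weyl_sum w I (r : seq I) P (F : I -> cochars D) :
  w (\sum_(i <- r | P i) F i) = \sum_(i <- r | P i) w (F i).
Proof. by rewrite (big_morph w (weylD w) (weyl0 w)). Qed.

Lemma weylMz w l (n : int) : w (l *~ n) = w l *~ n.
Proof.
have H (m : nat) : w (l *+ m) = w l *+ m.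
  by elim: m => [|m IH]; rewrite ?weyl0 // !mulrS weylD IH.
by case: n => n; rewrite ?NegzE ?mulrNz ?weylN -?pmulrn H.
Qed.

Lemma pairing_weyl_char w x l :
  pairing (weyl_char w x) l = pairing x ((w^-1)%g l).
Proof.
rewrite /weyl_char pairing_suml {2}(cobasis_span l) weyl_sum pairing_sumr.
by apply: eq_bigr => i _; rewrite weylMz pairingMzl pairingMzr mulrC.
Qed.

Lemma weyl_charM w u x : weyl_char (w * u)%g x = weyl_char w (weyl_char u x).
Proof. by apply: chars_ext => l; rewrite !pairing_weyl_char invgM. Qed.

Lemma weyl_char1 x : weyl_char 1%g x = x.
Proof. by apply: chars_ext => l; rewrite pairing_weyl_char invg1. Qed.

Lemma weyl_charK w : cancel (weyl_char w) (weyl_char w^-1%g).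
Proof. by move=> x; rewrite -weyl_charM mulVg weyl_char1. Qed.

Lemma weyl_charVK w : cancel (weyl_char w^-1%g) (weyl_char w).
Proof. by move=> x; rewrite -weyl_charM mulgV weyl_char1. Qed.

Lemma weyl_charD w x y : weyl_char w (x + y) = weyl_char w x + weyl_char w y.
Proof.
by apply: chars_ext => l; rewrite pairingDl !pairing_weyl_char pairingDl.
Qed.

Lemma weyl_charN w x : weyl_char w (- x) = - weyl_char w x.
Proof. by apply: chars_ext => l; rewrite pairingNl !pairing_weyl_char pairingNl. Qed.

Lemma weyl_charMz w x (n : int) : weyl_char w (x *~ n) = weyl_char w x *~ n.
Proof.
by apply: chars_ext => l; rewrite pairingMzl !pairing_weyl_char pairingMzl.
Qed.

Lemma srefl_inv i : ((srefl i : weyl D)^-1)%g = srefl i.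
Proof.
apply: (mulgI (srefl i)); rewrite mulgV; apply: weyl_ext => l.
by rewrite weylM /= coreflK // simple_root.
Qed.

Lemma weyl_char_srefl i x : weyl_char (srefl i) x = charefl (simple i) x.
Proof.
by apply: chars_ext => l; rewrite pairing_weyl_char pairing_charefl srefl_inv.
Qed.

Lemma weyl_char_root w a : a \in roots D -> weyl_char w a \in roots D.
Proof.
elim/weyl_ind: w a => [|i w IH] a ha; first by rewrite weyl_char1.
by rewrite weyl_charM weyl_char_srefl charefl_root ?simple_root ?IH.
Qed.

Lemma coroot_weyl_char w a : a \in roots D -> coroot (weyl_char w a) = w (coroot a).
Proof.
elim/weyl_ind: w a => [|i w IH] a ha; first by rewrite weyl_char1.
rewrite weyl_charM weyl_char_srefl coroot_charefl ?simple_root ?weyl_char_root //.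
by rewrite IH.
Qed.

Lemma corefl_weyl_char w a l : a \in roots D ->
  corefl (weyl_char w a) l = w (corefl a ((w^-1)%g l)).
Proof.
move=> ha; rewrite /corefl coroot_weyl_char // pairing_weyl_char weylD weylN weylMz.
by rewrite -weylM mulgV.
Qed.
End Roots.

(** * Positive roots *)

Section PositiveRoots.
Variable D : based_root_datum.
Implicit Types (a b c x y : chars D) (l m : cochars D) (w u : weyl D).
Implicit Types i j : 'I_(ssrk D).

Lemma dom0P x : dominates x 0 <->
  exists c : 'I_(ssrk D) -> nat, x = \sum_i simple i *~ (c i)%:Z.
Proof. by rewrite /dominates subr0. Qed.

Lemma dominatesE x y : dominates x y <-> dominates (x - y) 0.
Proof. by rewrite /dominates subr0. Qed.

Lemma dom0D x y : dominates x 0 -> dominates y 0 -> dominates (x + y) 0.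
Proof.
move=> /dom0P[c ->] /dom0P[d ->]; apply/dom0P; exists (fun i => (c i + d i)%N).
by rewrite -big_split; apply: eq_bigr => i _; rewrite PoszD mulrzDr.
Qed.

Lemma dom0Mn x n : dominates x 0 -> dominates (x *+ n) 0.
Proof.
move=> /dom0P[c ->]; apply/dom0P; exists (fun i => (c i * n)%N).
by rewrite -sumrMnl; apply: eq_bigr => i _; rewrite PoszM mulrzA.
Qed.

Lemma dom00 : dominates (0 : chars D) 0.
Proof.
by apply/dom0P; exists (fun=> 0%N); rewrite big1 // => i _; rewrite mulr0z.
Qed.

Lemma dominates_refl x : dominates x x.
Proof. by apply/dominatesE; rewrite subrr; exact: dom00. Qed.

Lemma dominates_trans y x z : dominates x y -> dominates y z -> dominates x z.
Proof.
move=> /dominatesE h /dominatesE h'; apply/dominatesE.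
by rewrite -(subrKA y); apply: dom0D.
Qed.

Lemma simple_coef (c d : 'I_(ssrk D) -> int) :
  \sum_i simple i *~ c i = \sum_i simple i *~ d i -> c =1 d.
Proof.
move=> e i; apply/eqP; rewrite -subr_eq0; apply/eqP; move: i.
apply: (@simple_free D (fun i => c i - d i)).
under eq_bigr do rewrite mulrzBr.
by rewrite sumrB e subrr.
Qed.

Lemma simpleE i : simple i = \sum_j simple j *~ (j == i)%:Z :> chars D.
Proof.
rewrite (bigD1 i) //= eqxx mulr1z big1 ?addr0 // => j /negPf ->.
by rewrite mulr0z.
Qed.

Lemma dom0_anti x : dominates x 0 -> dominates (- x) 0 -> x = 0.
Proof.
move=> /dom0P[c xc] /dom0P[d xd].
have h i : (c i)%:Z + (d i)%:Z = 0.
  move: i; apply: simple_free; under eq_bigr do rewrite mulrzDr.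
  by rewrite big_split /= -xc -xd subrr.
rewrite xc big1 // => i _; suff -> : c i = 0%N by rewrite mulr0z.
by have := h i; lia.
Qed.

Lemma dom0_pairing_ge0 x l : (forall i, 0 <= pairing (simple i) l) ->
  dominates x 0 -> 0 <= pairing x l.
Proof.
move=> hl /dom0P[c ->]; rewrite pairing_suml sumr_ge0 // => i _.
by rewrite pairingMzl mulr_ge0.
Qed.

Lemma posrootP a : reflect (a \in roots D /\ dominates a 0) (posroot a).
Proof.
by apply: (iffP andP) => -[h1 h2]; split => //; [exact/asboolP | exact/asboolP].
Qed.

Lemma posroot_root a : posroot a -> a \in roots D.
Proof. by case/andP. Qed.

Lemma posrootN a : a \in roots D -> posroot (- a) = ~~ posroot a.
Proof.
move=> ha; apply/idP/idP => [/posrootP[_ hN]|].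
  apply/negP => /posrootP[_ hp]; have := root_neq0 ha.
  by rewrite (dom0_anti hp hN) eqxx.
move/posrootP => h; apply/posrootP; split; first by rewrite opp_rootE.
have [c [e|e]] := simple_base ha; last first.
  by apply/dom0P; exists c; rewrite e opprK.
by case: h; split=> //; apply/dom0P; exists c.
Qed.

Lemma posroot_simple i : posroot (simple i : chars D).
Proof.
apply/posrootP; split; first exact: simple_root.
by apply/dom0P; exists (fun j => (j == i) : nat); exact: simpleE.
Qed.

Lemma negroot_simple i : posroot (- simple i : chars D) = false.
Proof. by rewrite posrootN ?simple_root // posroot_simple. Qed.

Lemma root_pos_ind (P : chars D -> Prop) :
  (forall a, a \in roots D -> P a -> P (- a)) ->
  (forall a, posroot a -> P a) -> forall a, a \in roots D -> P a.
Proof.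
move=> PN Pp a ha; case: (boolP (posroot a)) => [/Pp //|].
rewrite -posrootN // => /Pp h; rewrite -[a]opprK; apply: PN => //.
by rewrite opp_rootE.
Qed.

(** Otherwise the root [s_j alpha_i = alpha_i - n alpha_j] would have coefficients of both signs. *)
Lemma simple_pairing_le0 i j : i != j ->
  pairing (simple i) (coroot (simple j : chars D)) <= 0.
Proof.
move=> ij; rewrite leNgt; apply/negP => n0.
set n := pairing _ _ in n0.
have hr : charefl (simple j) (simple i) \in roots D.
  by rewrite charefl_root ?simple_root.
have e : charefl (simple j) (simple i) =
    \sum_k simple k *~ ((k == i)%:Z - n * (k == j)%:Z).
  under eq_bigr do rewrite mulrzBr [n * _]mulrC mulrzA.
  by rewrite sumrB -mulrz_suml -!simpleE.
case: (boolP (posroot (charefl (simple j) (simple i)))) => [|].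
  case/posrootP => _ /dom0P[c]; rewrite e => /simple_coef /(_ j).
  by rewrite eqxx eq_sym (negPf ij); lia.
rewrite -posrootN // => /posrootP[_ /dom0P[c]]; rewrite e -sumrN.
under eq_bigr do rewrite -mulrNz.
by move/simple_coef/(_ i); rewrite eqxx (negPf ij); lia.
Qed.

Definition absroot a := if posroot a then a else - a.

Definition posroots : seq (chars D) := [seq a <- roots D | posroot a].

Lemma mem_posroots a : (a \in posroots) = posroot a.
Proof. by rewrite mem_filter; case: posrootP => //= -[]. Qed.

Lemma posroots_uniq : uniq posroots.
Proof. exact/filter_uniq/roots_uniq. Qed.

Lemma absroot_pos a : a \in roots D -> posroot (absroot a).
Proof. by move=> ha; rewrite /absroot; case: ifPn => // h; rewrite posrootN. Qed.

Lemma absroot_id a : posroot a -> absroot a = a.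
Proof. by rewrite /absroot => ->. Qed.

Lemma absrootN a : a \in roots D -> absroot (- a) = absroot a.
Proof. by move=> ha; rewrite /absroot posrootN // opprK; case: posroot. Qed.

Lemma absrootP a b : absroot a = absroot b -> a = b \/ a = - b.
Proof.
rewrite /absroot; case: ifP => _; case: ifP => _ h; [by left | by right | |].
  by right; rewrite -h opprK.
by left; exact: oppr_inj.
Qed.

Lemma perm_posroots w :
  perm_eq [seq absroot (weyl_char w a) | a <- posroots] posroots.
Proof.
have sub : {subset [seq absroot (weyl_char w a) | a <- posroots] <= posroots}.
  move=> _ /mapP[a ha ->]; rewrite !mem_posroots in ha *.
  move/posroot_root in ha.
  by rewrite absroot_pos // weyl_char_root.
have uI : uniq [seq absroot (weyl_char w a) | a <- posroots].
  rewrite map_inj_in_uniq ?posroots_uniq // => a b.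
  rewrite !mem_posroots => ha hb /absrootP[|] h.
    exact: (can_inj (weyl_charK w)) h.
  move: h; rewrite -weyl_charN => /(can_inj (weyl_charK w)) h.
  by move: ha; rewrite h posrootN ?posroot_root // hb.
have [|_ e] := uniq_min_size uI sub; first by rewrite !size_map.
by apply: uniq_perm => //; exact: posroots_uniq.
Qed.
End PositiveRoots.

(** * Consequences of reducedness: heights, reflections and the exchange condition *)

Section Reduced.
Variable D : based_root_datum.
Hypothesis D_reduced : reduced D.
Implicit Types (a b c x y : chars D) (l m : cochars D) (w u : weyl D).
Implicit Types i j : 'I_(ssrk D).

(** The reflection changes only the coefficient of [alpha_i]. If the image were negative, all other
    coefficients of [a] would vanish, and a positive root proportional to [alpha_i] is [alpha_i] by
    reducedness. *)
Lemma charefl_simple_pos i a :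
  posroot a -> a != simple i -> posroot (charefl (simple i) a).
Proof.
move=> /posrootP[ha /dom0P[c ec]] ai.
have hr := charefl_root (simple_root i) ha.
case: (boolP (posroot (charefl _ _))) => //.
rewrite -posrootN // => /posrootP[_ /dom0P[d ed]].
set n := pairing a (coroot (simple i)).
have e : charefl (simple i) a = \sum_k simple k *~ ((c k)%:Z - n * (k == i)%:Z).
  under eq_bigr do rewrite mulrzBr [n * _]mulrC mulrzA.
  by rewrite sumrB -ec -mulrz_suml -!simpleE.
have c0 k : k != i -> c k = 0%N.
  move=> ki; move: ed; rewrite e -sumrN; under eq_bigr do rewrite -mulrNz.
  by move/simple_coef/(_ k); rewrite (negPf ki); lia.
have aE : a = simple i *~ (c i)%:Z.
  rewrite ec (bigD1 i) //= big1 ?addr0 // => k /c0 ->.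
  by rewrite mulr0z.
have aE1 : a *~ 1 = simple i *~ (c i)%:Z by rewrite mulr1z.
have [] := D_reduced (simple_root i) ha (isT : (1 : int) != 0) aE1 => h.
  by rewrite h eqxx in ai.
have : posroot a by apply/posrootP; split=> //; apply/dom0P; exists c.
by rewrite h negroot_simple.
Qed.

(** This is [2 rho^v]. It yields [height], which is twice the usual height, and its multiples are
    the dominant translations used for alcove walks. *)
Definition pos_cosum : cochars D := \sum_(a <- posroots D) coroot a.

(** Since [s_i] permutes the positive roots other than [alpha_i], it maps [2 rho^v] to
    [2 rho^v - 2 alpha_i^v]; pairing with [alpha_i] turns this into [- p = p - 4]. *)
Lemma pairing_pos_cosum i : pairing (simple i) pos_cosum = 2.
Proof.
have hi := simple_root i.
have h : pos_cosum - coroot (simple i) *~ 2 = srefl i pos_cosum; last first.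
  have : pairing (simple i) (srefl i pos_cosum) = - pairing (simple i) pos_cosum.
    by rewrite -[RHS]pairingNl -charefl_self // pairing_charefl.
  by rewrite -h pairingBr pairingMzr pairing_coroot //; lia.
have mem_i : simple i \in posroots D by rewrite mem_posroots posroot_simple.
have e : pos_cosum = coroot (simple i) + \sum_(a <- posroots D | a != simple i)
    coroot (absroot (weyl_char (srefl i) a)).
  rewrite /pos_cosum -(perm_big _ (perm_posroots (srefl i))) big_map.
  rewrite (bigD1_seq (simple i)) ?posroots_uniq //=.
  by rewrite weyl_char_srefl charefl_self // absrootN // absroot_id ?posroot_simple.
rewrite {1}e /pos_cosum weyl_sum (bigD1_seq (simple i)) ?posroots_uniq //.
rewrite -(coroot_weyl_char (srefl i)) // weyl_char_srefl charefl_self // corootN //.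
rewrite addrAC -[2]/(1 + 1) mulrzDr mulr1z opprD addNKr; congr (_ + _).
rewrite [LHS]big_seq_cond [RHS]big_seq_cond.
apply: eq_bigr => a /andP[]; rewrite mem_posroots => pa ai.
rewrite weyl_char_srefl absroot_id ?charefl_simple_pos //.
by rewrite coroot_charefl // posroot_root.
Qed.

Definition height a : int := pairing a pos_cosum.

Lemma height_ge0 x : dominates x 0 -> 0 <= height x.
Proof. by apply: dom0_pairing_ge0 => i; rewrite pairing_pos_cosum. Qed.

Lemma height_le0 x : dominates x 0 -> height x <= 0 -> x = 0.
Proof.
move=> /dom0P[c ->]; rewrite /height pairing_suml.
under eq_bigr do rewrite pairingMzl pairing_pos_cosum.
move=> h; rewrite big1 // => i _; suff -> : c i = 0%N by rewrite mulr0z.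
apply/eqP; move: h; rewrite (bigD1 i) //=; set S := (X in _ + X).
have : 0 <= S by apply: sumr_ge0.
by lia.
Qed.

Lemma height_posroot a : posroot a -> 0 < height a.
Proof.
move=> /posrootP[ha hp]; rewrite ltNge; apply/negP => /(height_le0 hp) a0.
by have := root_neq0 ha; rewrite a0 eqxx.
Qed.

(** Otherwise [<a, a^v> = 2] would be a sum of nonpositive terms. *)
Lemma posroot_simple_gt0 a :
  posroot a -> exists i, 0 < pairing a (coroot (simple i)).
Proof.
move=> /posrootP[ha /dom0P[c ec]]; apply: contrapT => h.
have {}h i : pairing (simple i) (coroot a) <= 0.
  rewrite leNgt -pairing_coroot_gt0 ?simple_root //.
  by apply/negP => h'; apply: h; exists i.
have := pairing_coroot ha; rewrite {1}ec pairing_suml => e.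
suff : \sum_i pairing (simple i *~ (c i)%:Z) (coroot a) <= 0 by rewrite e.
by apply: sumr_le0 => i _; rewrite pairingMzl mulr_le0_ge0.
Qed.

Lemma height_charefl i a :
  height (charefl (simple i) a) = height a - 2 * pairing a (coroot (simple i)).
Proof. by rewrite /height /charefl pairingBl pairingMzl pairing_pos_cosum. Qed.

(** Every root is conjugate to a simple one: by [posroot_simple_gt0] some simple reflection lowers
    the height of a positive root, which stays positive until it is simple. *)
Lemma root_simple_ind (P : chars D -> Prop) :
  (forall i, P (simple i)) ->
  (forall i a, a \in roots D -> P a -> P (charefl (simple i) a)) ->
  forall a, a \in roots D -> P a.
Proof.
move=> Ps Pr a ha; have Pp b : posroot b -> P b /\ P (- b).
  have [n] := ubnP `|height b|%N; elim: n b => // n IH b hn pb.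
  have [i n0] := posroot_simple_gt0 pb; have hi := simple_root i.
  have [->|bi] := eqVneq b (simple i).
    by split=> //; rewrite -charefl_self //; apply: Pr.
  have pb' := charefl_simple_pos pb bi.
  have [|P1 P2] := IH _ _ pb'.
    rewrite height_charefl; have := height_posroot pb'; rewrite height_charefl.
    by lia.
  have hb := posroot_root pb; have e : charefl (simple i) (charefl (simple i) b) = b.
    by apply: chars_ext => l; rewrite !pairing_charefl coreflK.
  split; first by rewrite -e; apply: Pr; rewrite ?charefl_root.
  have -> : - b = charefl (simple i) (- charefl (simple i) b).
    apply: chars_ext => l; rewrite pairing_charefl !pairingNl pairing_charefl.
    by rewrite coreflK.
  by apply: Pr => //; rewrite opp_rootE charefl_root.
case: (boolP (posroot a)) => [/Pp[] //|].
by rewrite -posrootN // => /Pp[_]; rewrite opprK.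
Qed.

(** The point is that the reflection belongs to the Weyl group, so [refl] does not fall back to 1.
    This passes from [a] to [s_i a] by conjugation with [s_i]. *)
Lemma refl_root a : a \in roots D -> forall l, refl a l = corefl a l.
Proof.
move=> ha; suff h : weyl_fun (corefl a).
  by move=> l; rewrite /refl /insubd insubT ?asboolT.
elim/root_simple_ind: a / ha => [i|i a ha h].
  by change (weyl_fun (corefl (simple i : chars D) \o id)); apply/weyl_step/weyl_id.
have -> : corefl (charefl (simple i) a) =
    (corefl (simple i) \o id) \o (corefl a \o (corefl (simple i) \o id)).
  apply: funext => l /=; rewrite -weyl_char_srefl corefl_weyl_char //.
  by rewrite srefl_inv.
have hs := weyl_step i (weyl_id D).
by apply: weyl_fun_comp => //; apply: weyl_fun_comp.
Qed.

Lemma refl_inv a : a \in roots D -> ((refl a)^-1 = refl a)%g.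
Proof.
move=> ha; apply: (mulgI (refl a)); rewrite mulgV; apply: weyl_ext => l.
by rewrite weylM !refl_root // coreflK.
Qed.

Lemma weyl_char_refl a x : a \in roots D -> weyl_char (refl a) x = charefl a x.
Proof.
move=> ha; apply: chars_ext => l.
by rewrite pairing_weyl_char pairing_charefl refl_inv // refl_root.
Qed.

Lemma refl_simple i : refl (simple i) = srefl i.
Proof. by apply: weyl_ext => l; rewrite refl_root ?simple_root. Qed.

Lemma refl_weyl_char w a : a \in roots D ->
  (refl (weyl_char w a) = w * refl a * w^-1)%g.
Proof.
move=> ha; apply: weyl_ext => l; rewrite refl_root ?weyl_char_root //.
by rewrite corefl_weyl_char // !weylM refl_root.
Qed.

Lemma srefl2 i : (srefl i * srefl i = 1 :> weyl D)%g.
Proof. by rewrite -{1}srefl_inv mulVg. Qed.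

Definition weyl_word (t : seq 'I_(ssrk D)) : weyl D :=
  foldr (fun i w => srefl i * w)%g 1%g t.

Lemma weyl_wordP w : exists t, w = weyl_word t.
Proof.
elim/weyl_ind: w => [|i w [t ->]]; first by exists [::].
by exists (i :: t).
Qed.

(** Exchange condition. Reading the word, [a] stays positive until it equals the current simple
    root, and there the reflection cancels that letter. *)
Lemma weyl_exchange t a : posroot a ->
    ~~ posroot (weyl_char (weyl_word t)^-1%g a) ->
  exists2 t', size t = (size t').+1 & (refl a * weyl_word t)%g = weyl_word t'.
Proof.
elim: t a => [|i t IH] a pa /=; first by rewrite invg1 weyl_char1 pa.
rewrite invgM srefl_inv weyl_charM weyl_char_srefl => h.
have ha := posroot_root pa.
have [ai|ai] := eqVneq a (simple i).
  exists t => //; by rewrite ai refl_simple mulgA srefl2 mul1g.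
have [t' st et] := IH _ (charefl_simple_pos pa ai) h.
exists (i :: t'); rewrite /= ?st // -et.
rewrite -weyl_char_srefl refl_weyl_char // srefl_inv !mulgA.
by rewrite srefl2 mul1g.
Qed.

(** Take a shortest word, with first letter [s_i] and tail [u]. As [w^-1 alpha_i] is positive,
    [u^-1 alpha_i] is negative, so exchange writes [s_i u = w] with fewer letters. *)
Lemma weyl_eq1 w : (forall a, posroot a -> posroot (weyl_char w a)) -> w = 1%g.
Proof.
move=> pw; have ex : exists n, `[< exists2 t, size t = n & w = weyl_word t >].
  by have [t ->] := weyl_wordP w; exists (size t); apply/asboolP; exists t.
case: (ex_minnP ex) => n /asboolP[[|i t] st ew] min_n; first by [].
have pw' : posroot (weyl_char w^-1%g (simple i)).
  case: (boolP (posroot _)) => // h.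
  have hi := weyl_char_root w^-1%g (simple_root i).
  move: h; rewrite -posrootN // => /pw; rewrite weyl_charN weyl_charVK.
  by rewrite negroot_simple.
have [|t' st' et'] := @weyl_exchange t (simple i) (posroot_simple i).
  rewrite -posrootN ?weyl_char_root ?simple_root // -weyl_charN.
  move: pw'; rewrite ew /= invgM srefl_inv weyl_charM weyl_char_srefl.
  by rewrite charefl_self ?simple_root.
have : (n <= size t')%N.
  by apply: min_n; apply/asboolP; exists t' => //; rewrite ew -et' refl_simple.
by rewrite -st /= st'; lia.
Qed.
End Reduced.

(** * The highest root *)

Section HighestRoot.
Variable D : based_root_datum.
Hypotheses (D_reduced : reduced D) (D_irreducible : irreducible D).
Implicit Types (a b c x y t : chars D) (l m : cochars D) (w u : weyl D).
Implicit Types i j : 'I_(ssrk D).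

Lemma dom0_height_eq x y :
  dominates x y -> height x <= height y -> x = y.
Proof.
move=> /dominatesE h hxy; apply/eqP; rewrite -subr_eq0; apply/eqP.
by apply: height_le0 => //; rewrite /height pairingBl subr_le0.
Qed.

Lemma dominates_height x y : dominates x y -> height y <= height x.
Proof.
by move=> /dominatesE /(height_ge0 D_reduced); rewrite /height pairingBl subr_ge0.
Qed.

Definition maximal_root t :=
  t \in roots D /\ {in roots D, forall b, dominates b t -> b = t}.

(** A root that is not maximal lies below another one of larger height, and the heights of the
    finitely many roots are bounded. *)
Lemma maximal_root_above a : a \in roots D ->
  exists2 t, maximal_root t & dominates t a.
Proof.
move=> ha; pose N := (\sum_(c <- roots D) `|height c|)%N.
have bnd b : b \in roots D -> (`|height b| <= N)%N.
  by move=> hb; rewrite /N (big_rem b) //= leq_addr.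
have [n] := ubnP `|N%:Z - height a|%N; elim: n a ha => // n IH a ha hn.
case: (pselect (maximal_root a)) => [|nm].
  by exists a => //; exact: dominates_refl.
have [b [hb dba bna]] : exists b, [/\ b \in roots D, dominates b a & b <> a].
  apply: contrapT => h; apply: nm; split=> // b hb dba; apply: contrapT => bna.
  by apply: h; exists b.
have hlt : height a < height b.
  by rewrite ltNge; apply/negP => /(dom0_height_eq dba).
have [|t mt dt] := IH b hb; first by have := bnd _ hb; lia.
by exists t => //; apply: dominates_trans dba.
Qed.

Lemma maximal_root_pos t : maximal_root t -> posroot t.
Proof.
move=> [ht mt]; case: (boolP (posroot t)) => //; rewrite -posrootN // => h.
have pN : - t \in roots D by rewrite opp_rootE.
suff e : - t = t by move: (h); rewrite posrootN // -{1}e h.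
apply: mt => //; apply/dominatesE; rewrite -mulr2n; apply: dom0Mn.
by case/posrootP: h.
Qed.

(** If the pairing were negative, the root [s_i t] would lie strictly above [t]. *)
Lemma maximal_root_dominant t i :
  maximal_root t -> 0 <= pairing t (coroot (simple i)).
Proof.
move=> [ht mt]; rewrite leNgt; apply/negP => n0.
have h : charefl (simple i) t = t.
  apply: mt; first by rewrite charefl_root ?simple_root.
  apply/dominatesE; rewrite /charefl addrC addKr; apply/dom0P.
  exists (fun j => if j == i then `|pairing t (coroot (simple i))|%N else 0%N).
  rewrite (bigD1 i) //= eqxx big1 ?addr0 => [|j /negPf ->]; last by rewrite mulr0z.
  by rewrite -mulrNz; congr (_ *~ _); lia.
by have := height_charefl D_reduced i t; rewrite h; lia.
Qed.

Lemma maximal_root_pairing t b : maximal_root t -> dominates b 0 ->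
  0 <= pairing b (coroot t).
Proof.
move=> mt; apply: dom0_pairing_ge0 => i; have ht := mt.1.
by rewrite leNgt -pairing_coroot_lt0 ?simple_root // -leNgt maximal_root_dominant.
Qed.

(** The condition on the coroot is carried along so that, when no edge of the Dynkin diagram leaves
    [J], the property is stable under all simple reflections, including those outside [J]. *)
Definition supported (J : pred 'I_(ssrk D)) a :=
  (exists2 c : 'I_(ssrk D) -> int, a = \sum_i simple i *~ c i
     & forall i, ~~ J i -> c i = 0) /\
  (forall j, ~~ J j -> pairing (simple j) (coroot a) = 0).

Lemma supported_charefl (J : pred 'I_(ssrk D)) i a :
  (forall i j, J i -> ~~ J j -> pairing (simple j) (coroot (simple i : chars D)) = 0) ->
  a \in roots D -> supported J a -> supported J (charefl (simple i) a).
Proof.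
move=> hJ ha [[c ac c0] ca]; have hi := simple_root i.
case: (boolP (J i)) => Ji; last first.
  suff -> : charefl (simple i) a = a by split=> //; exists c.
  have /eqP := ca i Ji; rewrite pairing_coroot_eq0 // /charefl => /eqP ->.
  by rewrite mulr0z subr0.
split.
  exists (fun k => c k - pairing a (coroot (simple i)) * (k == i)%:Z).
    under eq_bigr do rewrite mulrzBr [pairing _ _ * _]mulrC mulrzA.
    by rewrite sumrB -ac -mulrz_suml -simpleE.
  move=> k Jk; rewrite c0 //; have [ki|] := eqVneq k i; last by rewrite mulr0.
  by rewrite ki Ji in Jk.
move=> j Jj; rewrite coroot_charefl // pairingBr pairingMzr ca //.
by rewrite hJ // mul0r subr0.
Qed.

(** Let [J] be the support of [t]. For [j] outside [J], the pairing [<t, alpha_j^v>] is nonnegative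
    by dominance but a sum of nonpositive terms, so no edge leaves [J]. Irreducibility then makes
    [J] everything. *)
Lemma maximal_root_support t : maximal_root t ->
  exists2 c : 'I_(ssrk D) -> nat, t = \sum_i simple i *~ (c i)%:Z
    & forall i, (0 < c i)%N.
Proof.
move=> mt; have ht := mt.1.
have /posrootP[_ /dom0P[c ec]] := maximal_root_pos mt; exists c => //.
pose J i := (0 < c i)%N.
have hJ i j : J i -> ~~ J j -> pairing (simple i) (coroot (simple j : chars D)) = 0.
  move=> Ji Jj; have := maximal_root_dominant j mt.
  have cj : c j = 0%N by move: Jj; rewrite /J; lia.
  rewrite ec pairing_suml (bigD1 i) //=; set S := \sum_(_ | _) _.
  have : S <= 0.
    apply: sumr_le0 => k ki; rewrite pairingMzl; have [->|kj] := eqVneq k j.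
      by rewrite cj mulr0.
    by rewrite mulr_le0_ge0 // simple_pairing_le0.
  have ij : i != j by apply: contraNneq Jj => <-.
  have := simple_pairing_le0 ij; rewrite pairingMzl.
  by move: (Ji); rewrite /J; nia.
have hJ' i j : J i -> ~~ J j -> pairing (simple j) (coroot (simple i : chars D)) = 0.
  by move=> Ji Jj; apply/eqP; rewrite pairing_coroot_eq0 ?simple_root // hJ.
have supp a : a \in roots D -> supported J a \/ supported (predC J) a.
  move=> ha; elim/(root_simple_ind D_reduced): a / ha => [i|i a ha [] h].
  - have si (K : pred 'I_(ssrk D)) : K i ->
      (forall i j, K i -> ~~ K j -> pairing (simple j) (coroot (simple i : chars D)) = 0) ->
      supported K (simple i).
      move=> Ki hK; split=> [|j Kj]; last exact: hK.
      exists (fun j => (j == i)%:Z); first exact: simpleE.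
      by move=> j Kj; case: eqP => // ji; rewrite ji Ki in Kj.
    case: (boolP (J i)) => Ji; [left | right]; apply: si => //.
    by move=> k j /= Jk; rewrite negbK => Jj; exact: hJ.
  - by left; apply: supported_charefl.
  - right; apply: supported_charefl => // k j /= Jk; rewrite negbK => Jj.
    exact: hJ.
have [|h i|h] := D_irreducible.2 [pred a | `[< supported J a >]].
- move=> a b ha hb /asboolP[[d ad d0] _] /asboolP Pb.
  have [|[_ bb]] := supp b hb => //.
  rewrite ad pairing_suml big1 // => i _; rewrite pairingMzl.
  case: (boolP (J i)) => Ji; last by rewrite d0 // mulr0.
  by rewrite bb ?mul0r //= Ji.
- have /asboolP[[d id d0] _] := h _ (simple_root i).
  rewrite lt0n; apply/negP => /eqP ci.
  have Ji : ~~ J i by rewrite /J ci.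
  by have := d0 i Ji; rewrite -(simple_coef (etrans (esym (simpleE i)) id)) eqxx.
- exfalso; have := root_neq0 ht; suff -> : t = 0 by rewrite eqxx.
  rewrite ec big1 // => i _; suff -> : c i = 0%N by rewrite mulr0z.
  apply/eqP; rewrite -leqn0 leqNgt; apply/negP => Ji.
  have := h _ (simple_root i); apply/negP; rewrite negbK; apply/asboolP; split.
    exists (fun j => (j == i)%:Z); first exact: simpleE.
    by move=> j Jj; case: eqP => // ji; rewrite ji /J Ji in Jj.
  by move=> j Jj; exact: hJ'.
Qed.

(** Full support and dominance make both pairings positive. If one of them is 1, then [t - t'] is a
    root up to sign and the two are comparable; otherwise both are at least 2 and
    [eq_root_pairing_ge2] applies. *)
Lemma maximal_root_unique t t' : maximal_root t -> maximal_root t' -> t = t'.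
Proof.
move=> mt mt'; have ht := mt.1; have ht' := mt'.1.
have [c ec c0] := maximal_root_support mt'.
have [d ed _] := maximal_root_support mt.
have n0 : 0 < pairing t' (coroot t).
  have ge0 i : 0 <= pairing (simple i) (coroot t).
    by apply: (maximal_root_pairing mt); case/posrootP: (posroot_simple i).
  rewrite lt_neqAle maximal_root_pairing //; last first.
    by case/posrootP: (maximal_root_pos mt').
  rewrite andbT eq_sym; apply/negP; rewrite ec pairing_suml psumr_eq0; last first.
    by move=> i _; rewrite pairingMzl mulr_ge0.
  move=> /allP h; have := pairing_coroot ht; rewrite {1}ed pairing_suml big1 //.
  move=> i _; have := h i (mem_index_enum _); rewrite /= !pairingMzl.
  rewrite mulf_eq0 => /orP[/eqP ->|]; first by rewrite mul0r.
  by have := c0 i; lia.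
have key s s' : maximal_root s -> maximal_root s' ->
    pairing s (coroot s') = 1 -> s = s'.
  move=> [hs ms] [hs' ms'] e1; have hr := charefl_root hs' hs.
  move: hr; rewrite /charefl e1 mulr1z => hr.
  case: (boolP (posroot (s - s'))) => [/posrootP[_ dh]|].
    by apply: ms' => //; apply/dominatesE.
  rewrite -posrootN // opprB => /posrootP[_ dh].
  by apply/esym/ms => //; apply/dominatesE.
have n0' : 0 < pairing t (coroot t') by rewrite pairing_coroot_gt0.
have [/(key _ _ mt' mt) //|n1] := eqVneq (pairing t' (coroot t)) 1.
have [/(key _ _ mt mt') //|n1'] := eqVneq (pairing t (coroot t')) 1.
by apply: eq_root_pairing_ge2 => //; lia.
Qed.

Lemma highest_rootP : highest_root D \in roots D /\
  {in roots D, forall b, dominates (highest_root D) b}.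
Proof.
have [r0 _] := D_irreducible; case er : (roots D) r0 => [//|a s] _.
have ha : a \in roots D by rewrite er mem_head.
have [t mt _] := maximal_root_above ha.
rewrite -er; apply: (xgetPex 0 (P := [set a | a \in roots D /\
  {in roots D, forall b, dominates a b}]%classic)); exists t; split; first exact: mt.1.
move=> b hb; have [t' mt' d] := maximal_root_above hb.
by rewrite (maximal_root_unique mt mt').
Qed.

Local Notation theta := (highest_root D).

Lemma highest_root_root : theta \in roots D. Proof. exact: highest_rootP.1. Qed.

Lemma dominates_highest b : b \in roots D -> dominates theta b.
Proof. exact: highest_rootP.2. Qed.

Lemma highest_root_maximal : maximal_root theta.
Proof.
split; first exact: highest_root_root.
move=> b hb h; apply: dom0_height_eq => //.
exact: dominates_height (dominates_highest hb).
Qed.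

Lemma posroot_highest : posroot theta.
Proof. exact: maximal_root_pos highest_root_maximal. Qed.

(** If [n = <b, theta^v>] is positive, heights show that [b - n theta] is negative. Its opposite is
    a root below [theta], so [b] has at least [n - 1] times the height of [theta], and [n >= 2]
    would give [b = theta]. *)
Lemma pairing_highest b : posroot b -> b != theta ->
  pairing b (coroot theta) = 0 \/
  pairing b (coroot theta) = 1 /\ ~~ posroot (charefl theta b).
Proof.
move=> pb bt; have [hb db] := posrootP _ pb; have ht := highest_root_root.
have := maximal_root_pairing highest_root_maximal db.
set n := pairing _ _ => n0; have [->|n0'] := eqVneq n 0; [by left | right].
have hr := charefl_root ht hb.
have hbt := dominates_height (dominates_highest hb).
have ht0 := height_posroot D_reduced posroot_highest.
have neg : ~~ posroot (charefl theta b).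
  apply/negP => /(height_posroot D_reduced).
  by rewrite /height pairingBl pairingMzl -!/(height _) -/n; nia.
split=> //; apply/eqP; case: eqP => // n1; exfalso.
move: neg; rewrite -posrootN // => /posroot_root /dominates_highest /dominates_height.
rewrite /height pairingNl pairingBl pairingMzl -!/(height _) -/n => h.
move/eqP: bt; apply; apply/esym/dom0_height_eq; first exact: dominates_highest.
by nia.
Qed.
End HighestRoot.

(** * The length function *)

Section Length.
Variable D : based_root_datum.
Implicit Types (a b x : chars D) (l m : cochars D) (w u : weyl D).
Implicit Types (g h : ext_weyl D) (j : 'I_(ssrk D)).

(* [offset g a] is the integer [n] such that [n < <a, y> < n + 1] for [y] in the
   alcove of [g]. *)
Definition offset g a : int :=
  pairing a g.1 - (~~ posroot (weyl_char (g.2^-1)%g a))%:Z.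

Lemma offsetM g h a :
  offset (g * h)%g a = pairing a g.1 + offset h (weyl_char (g.2^-1)%g a).
Proof.
rewrite /offset /= pairingDr pairing_weyl_char invgK addrA.
by rewrite invgM weyl_charM.
Qed.

Lemma offset1 a : offset 1%g a = - (~~ posroot a)%:Z.
Proof.
by rewrite /offset /= pairing0r add0r invg1 weyl_char1.
Qed.

Lemma offset1_pos a : posroot a -> offset 1%g a = 0.
Proof. by move=> pa; rewrite offset1 pa. Qed.

Lemma offsetN g a : a \in roots D -> offset g (- a) = - offset g a - 1.
Proof.
move=> ha; rewrite /offset weyl_charN posrootN ?weyl_char_root // pairingNl.
by case: posroot => /=; lia.
Qed.

Lemma ext1V g : ((g^-1)%g).1 = - (g.2^-1)%g g.1. Proof. by []. Qed.

Lemma ext2V g : ((g^-1)%g).2 = (g.2^-1)%g. Proof. by []. Qed.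

Lemma elen_inv_offset g : elen g = (\sum_(a <- posroots D) `|offset (g^-1)%g a|)%N.
Proof.
rewrite /posroots big_filter /elen.
rewrite [RHS](bigID (fun a => posroot (weyl_char g.2 a))) /= [RHS]addnC; congr (_ + _)%N.
  rewrite big_seq_cond [RHS]big_seq_cond; apply: eq_big => [a|a].
    case: (boolP (a \in roots D)) => //= ha.
    by rewrite posrootN ?weyl_char_root.
  move=> /andP[ha /andP[_]]; rewrite posrootN ?weyl_char_root // /offset.
  rewrite ext1V ext2V.
  by rewrite invgK pairingNr => -> /=; lia.
apply: eq_bigr => a /andP[_ pa]; rewrite /offset.
rewrite ext1V ext2V.
by rewrite invgK pairingNr pa /=; lia.
Qed.

(** Each summand counts the hyperplanes for [a] that separate the alcove of [g] from the base
    alcove. Reindexing by the positive one of [g.2 a] and its opposite exchanges [g] and [g^-1]. *)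
Lemma elenE g : elen g = (\sum_(a <- posroots D) `|offset g a|)%N.
Proof.
rewrite elen_inv_offset -[RHS](perm_big _ (perm_posroots g.2)) big_map.
apply: eq_big_seq => a; rewrite mem_posroots => pa; have ha := posroot_root pa.
have -> : offset (g^-1)%g a = - pairing (weyl_char g.2 a) g.1
      - (~~ posroot (weyl_char g.2 a))%:Z.
  rewrite /offset pairing_weyl_char.
  rewrite ext1V ext2V.
  by rewrite invgK pairingNr.
have e : offset g (weyl_char g.2 a) = pairing (weyl_char g.2 a) g.1.
  by rewrite /offset weyl_charK pa subr0.
rewrite /absroot; case: ifP => _; last rewrite offsetN ?weyl_char_root //.
  by rewrite e /=; lia.
by rewrite e /=; lia.
Qed.

Lemma elenV g : elen (g^-1)%g = elen g.
Proof. by rewrite elen_inv_offset invgK -elenE. Qed.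

Lemma elen1 : elen (1%g : ext_weyl D) = 0%N.
Proof.
rewrite elenE big1_seq // => a /andP[_]; rewrite mem_posroots => pa.
by rewrite offset1_pos.
Qed.

Lemma elen_eq0_offset g a : elen g = 0%N -> a \in roots D ->
  offset g a = offset 1%g a.
Proof.
move=> g0 ha; elim/root_pos_ind: a / ha => [a ha|a pa].
  by rewrite !offsetN // => ->.
have ap : a \in posroots D by rewrite mem_posroots.
move: g0; rewrite elenE (big_rem a) //= => /eqP; rewrite addn_eq0 => /andP[/eqP h _].
by rewrite offset1_pos //; lia.
Qed.

Lemma offset_mulr_len0 g h a : elen h = 0%N -> a \in roots D ->
  offset (g * h)%g a = offset g a.
Proof.
move=> h0 ha; rewrite offsetM elen_eq0_offset // ?weyl_char_root //.
by rewrite -offsetM mulg1.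
Qed.

Lemma elen_mulr_len0 g h : elen h = 0%N -> elen (g * h)%g = elen g.
Proof.
move=> h0; rewrite !elenE; apply: eq_big_seq => a; rewrite mem_posroots => pa.
by rewrite offset_mulr_len0 ?posroot_root.
Qed.

Lemma elen_mull_len0 g h : elen g = 0%N -> elen (g * h)%g = elen h.
Proof. by move=> g0; rewrite -elenV invgM elen_mulr_len0 elenV. Qed.

Lemma translD l m : (transl l * transl m = transl (l + m))%g.
Proof. by congr pair; exact: mulg1. Qed.

Lemma of_weylM w u : of_weyl (w * u)%g = (of_weyl w * of_weyl u)%g.
Proof. by congr pair; rewrite weyl0 addr0. Qed.

Lemma of_weylV w : of_weyl (w^-1)%g = ((of_weyl w)^-1)%g.
Proof.
by apply: (mulgI (of_weyl w)); rewrite mulgV -of_weylM mulgV.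
Qed.

Lemma offset_transl l a : posroot a -> offset (transl l) a = pairing a l.
Proof. by move=> pa; rewrite /offset /= invg1 weyl_char1 pa subr0. Qed.

Lemma offset_translM l g a : offset (transl l * g)%g a = pairing a l + offset g a.
Proof. by rewrite offsetM /= invg1 weyl_char1. Qed.

Lemma offset_of_weyl w a :
  offset (of_weyl w) a = - (~~ posroot (weyl_char (w^-1)%g a))%:Z.
Proof. by rewrite /offset /= pairing0r add0r. Qed.

Definition dominant l := forall j, 0 <= pairing (simple j) l.

Lemma dominant_pairing l a : dominant l -> posroot a -> 0 <= pairing a l.
Proof. by move=> hl /posrootP[_]; exact: dom0_pairing_ge0. Qed.

Lemma elen_translD l m : dominant l -> dominant m ->
  elen (transl l * transl m)%g = (elen (transl l) + elen (transl m))%N.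
Proof.
move=> hl hm; rewrite !elenE -big_split; apply: eq_big_seq => a.
rewrite mem_posroots => pa; rewrite translD !offset_transl // pairingDr.
by have := dominant_pairing hl pa; have := dominant_pairing hm pa => /=; lia.
Qed.

(** As [<a, l> >= 1], a positive root made negative by [w^-1] loses one in the first summand and
    regains it in the second. This is what identifies [t_w]. *)
Lemma elen_transl_weyl l w : (forall a, posroot a -> 0 < pairing a l) ->
  elen (transl l) = (elen (transl l * of_weyl w)%g + elen (of_weyl w^-1)%g)%N.
Proof.
move=> hl; rewrite of_weylV elenV !elenE -big_split; apply: eq_big_seq => a.
rewrite mem_posroots => pa; rewrite offset_translM offset_transl // offset_of_weyl.
by have := hl _ pa; case: posroot => /=; lia.
Qed.
End Length.

(** * Affine simple reflections *)

Section AffineReflections.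
Variable D : based_root_datum.
Hypotheses (D_reduced : reduced D) (D_irreducible : irreducible D).
Implicit Types (a b x : chars D) (l m : cochars D) (w u : weyl D).
Implicit Types (g h : ext_weyl D) (j : 'I_(ssrk D)) (i : 'I_(ssrk D).+1).
Local Notation theta := (highest_root D).

(** Gradients of the affine functions [alpha_j] and [1 - theta], which are positive on the base
    alcove. *)
Definition affine_simple i : chars D :=
  if unlift ord0 i is Some j then simple j else - theta.

Lemma affine_simple_root i : affine_simple i \in roots D.
Proof.
rewrite /affine_simple; case: unliftP => [j _|_]; first exact: simple_root.
by rewrite opp_rootE highest_root_root.
Qed.

Lemma arefl_lift j : arefl (lift ord0 j) = of_weyl (srefl j) :> ext_weyl D.
Proof. by rewrite /arefl liftK. Qed.

Lemma affine_simple_lift j : affine_simple (lift ord0 j) = simple j.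
Proof. by rewrite /affine_simple liftK. Qed.

Lemma arefl0 : arefl ord0 = (coroot theta, refl theta) :> ext_weyl D.
Proof. by rewrite /arefl unlift_none; congr pair; [exact: addr0 | exact: mul1g]. Qed.

Lemma affine_simple0 : affine_simple ord0 = - theta.
Proof. by rewrite /affine_simple unlift_none. Qed.

Lemma arefl2 i : (arefl i * arefl i = 1 :> ext_weyl D)%g.
Proof.
case: (unliftP ord0 i) => [j|] ->.
  by rewrite arefl_lift -of_weylM srefl2.
have ht := highest_root_root D_reduced D_irreducible.
rewrite arefl0; congr pair => /=; last first.
  by rewrite -{1}refl_inv // mulVg.
by rewrite refl_root // corefl_coroot // subrr.
Qed.

(** Only the wall of type [i] separates the base alcove from its image. For [i = 0], another
    positive root pairs with [theta^v] to 0, or to 1 while becoming negative; in the latter case the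
    shift by 1 and the sign correction cancel. *)
Lemma offset_arefl i a : a \in roots D ->
  offset (arefl i) a = offset 1%g a - (a == affine_simple i)%:Z
                       + (a == - affine_simple i)%:Z.
Proof.
pose P a := offset (arefl i) a = offset 1%g a - (a == affine_simple i)%:Z
                       + (a == - affine_simple i)%:Z.
rewrite -/(P a) => ha; elim/root_pos_ind: a / ha => [a ha|a pa]; rewrite /P.
  by rewrite !offsetN // eqr_oppLR eqr_opp => ->; lia.
have ha := posroot_root pa; rewrite offset1_pos //.
case: (unliftP ord0 i) => [j|] ->.
  rewrite arefl_lift affine_simple_lift offset_of_weyl srefl_inv weyl_char_srefl.
  have -> : (a == - simple j) = false.
    by apply/eqP => e; rewrite e negroot_simple in pa.
  have [->|aj] := eqVneq a (simple j).
    by rewrite charefl_self ?simple_root // negroot_simple.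
  by rewrite charefl_simple_pos.
have ht := highest_root_root D_reduced D_irreducible.
rewrite arefl0 affine_simple0 opprK /offset /= refl_inv // weyl_char_refl //.
have -> : (a == - theta) = false.
  apply/eqP => e; move: pa; rewrite e posrootN // posroot_highest //.
have [->|aj] := eqVneq a theta.
  by rewrite charefl_self // posrootN // posroot_highest // pairing_coroot.
have [e|[-> h]] := pairing_highest D_reduced D_irreducible pa aj.
  by rewrite /charefl e mulr0z subr0 pa.
by move/negPf: h => ->; lia.
Qed.
End AffineReflections.

(** * Steps between adjacent alcoves and induction on length *)

Section AffineDescent.
Variable D : based_root_datum.
Hypotheses (D_reduced : reduced D) (D_irreducible : irreducible D).
Implicit Types (a b x : chars D) (l m : cochars D) (w u : weyl D).
Implicit Types (g h : ext_weyl D) (j : 'I_(ssrk D)) (i : 'I_(ssrk D).+1).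
Local Notation theta := (highest_root D).
Local Notation offset_arefl := (offset_arefl D_reduced D_irreducible).
Local Notation affine_simple_root := (affine_simple_root D_reduced D_irreducible).

(** Points from the wall of type [i] into the alcove of [g]. *)
Definition wall_root i g : chars D := weyl_char g.2 (affine_simple i).

(* The step from the alcove of [g] across its wall of type [i] goes to the
   positive side exactly when [wall_root i g] is negative. *)
Definition upward i g : bool := ~~ posroot (wall_root i g).

Lemma wall_root_root i g : wall_root i g \in roots D.
Proof. exact/weyl_char_root/affine_simple_root. Qed.

Lemma offset_step i g a : a \in roots D ->
  offset (g * arefl i)%g a =
    offset g a - (a == wall_root i g)%:Z + (a == - wall_root i g)%:Z.
Proof.
move=> ha; rewrite offsetM offset_arefl ?weyl_char_root //.
have -> : offset g a = pairing a g.1 + offset 1%g (weyl_char (g.2^-1)%g a).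
  by rewrite -offsetM mulg1.
rewrite !addrA; congr (_ + _ + _).
  congr (- (nat_of_bool _)%:Z); rewrite -(inj_eq (can_inj (weyl_charK g.2))).
  by rewrite weyl_charVK.
congr ((nat_of_bool _)%:Z); rewrite -(inj_eq (can_inj (weyl_charK g.2))).
by rewrite weyl_charVK weyl_charN.
Qed.

Lemma offset_step_neq i g a : posroot a -> a != absroot (wall_root i g) ->
  offset (g * arefl i)%g a = offset g a.
Proof.
move=> pa ne; have ha := posroot_root pa; rewrite offset_step //.
case: eqP => [e|_].
  by rewrite e absroot_id ?eqxx // -e in ne.
case: eqP => [e|_]; last by rewrite subr0 addr0.
by move: ne; rewrite -absrootN ?wall_root_root // -e absroot_id ?eqxx.
Qed.

Lemma offset_step_eq i g : offset (g * arefl i)%g (absroot (wall_root i g)) =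
  offset g (absroot (wall_root i g)) + (if upward i g then 1 else - 1).
Proof.
have hb := wall_root_root i g; set b := wall_root i g in hb *.
rewrite offset_step ?posroot_root ?absroot_pos // -/b /upward -/b /absroot.
have nb : (b == - b) = false.
  apply/eqP => e; have := posrootN hb; rewrite -e; by case: posroot.
case: (boolP (posroot b)) => pb /=; first by rewrite eqxx nb addr0.
by rewrite eqxx eq_sym nb subr0.
Qed.

Lemma elen_step i g :
  (elen (g * arefl i)%g + `|offset g (absroot (wall_root i g))|)%:Z =
  (elen g)%:Z + `|offset g (absroot (wall_root i g))
                  + (if upward i g then 1 else - 1)|.
Proof.
have pb := absroot_pos (wall_root_root i g).
set b := absroot _ in pb *; have mb : b \in posroots D by rewrite mem_posroots.
rewrite !elenE !(bigD1_seq b) ?posroots_uniq //= offset_step_eq -/b.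
rewrite big_seq_cond [X in _ = (_ + X)%N%:Z + _]big_seq_cond.
under eq_bigr => a /andP[]; first rewrite mem_posroots => pa ab.
  rewrite offset_step_neq //; over.
rewrite /=; set S := (\sum_(_ <- _ | _) _)%N.
by case: upward; lia.
Qed.

Lemma elen_step_up i g : upward i g -> 0 <= offset g (absroot (wall_root i g)) ->
  elen (g * arefl i)%g = (elen g).+1.
Proof. by move=> up; have := elen_step i g; rewrite up; lia. Qed.

Lemma elen_step_down i g : ~~ upward i g ->
  0 < offset g (absroot (wall_root i g)) ->
  elen g = (elen (g * arefl i)%g).+1.
Proof. by move=> /negPf up; have := elen_step i g; rewrite up; lia. Qed.

Lemma elen_step_dich i g :
  elen (g * arefl i)%g = (elen g).+1 \/ elen g = (elen (g * arefl i)%g).+1.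
Proof. by have := elen_step i g; case: upward; lia. Qed.

Lemma elen_arefl i : elen (arefl i : ext_weyl D) = 1%N.
Proof.
have := elen_step i 1%g; rewrite mul1g elen1 offset1_pos.
  by case: upward; lia.
exact/absroot_pos/wall_root_root.
Qed.

Lemma offset_weyl_char g b :
  offset g (weyl_char g.2 b) = pairing b ((g.2^-1)%g g.1) - (~~ posroot b)%:Z.
Proof. by rewrite /offset weyl_charK pairing_weyl_char. Qed.

(* If no step from [g] is shorter, then [l = g.2^-1 g.1] satisfies
   [<a, l> = - [g.2 a < 0]] on the affine simple roots, hence on all positive
   roots, as these lie between [0] and [theta]. *)
Lemma elen_descent g : (0 < elen g)%N ->
  exists i, elen g = (elen (g * arefl i)%g).+1.
Proof.
move=> g0; apply: contrapT => h; move: g0; rewrite -elenV elenE.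
have {}h i : offset g (wall_root i g) <= - (upward i g)%:Z.
  have e : elen (g * arefl i)%g = (elen g).+1.
    by have [//|e] := elen_step_dich i g; case: h; exists i.
  have := elen_step i g; rewrite e; have := offsetN g (wall_root_root i g).
  rewrite /absroot /upward; case: posroot => /=; first by lia.
  by move=> ->; lia.
set l := (g.2^-1)%g g.1.
have hs j : pairing (simple j) l <= - (~~ posroot (weyl_char g.2 (simple j)))%:Z.
  have := h (lift ord0 j); rewrite /upward /wall_root affine_simple_lift.
  by rewrite offset_weyl_char posroot_simple subr0.
have ptheta := posroot_highest D_reduced D_irreducible.
have rtheta := posroot_root ptheta.
have ht : - 1 - pairing theta l <= - (posroot (weyl_char g.2 theta))%:Z.
  have := h ord0; rewrite /upward /wall_root affine_simple0 offset_weyl_char.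
  rewrite pairingNl posrootN // ptheta weyl_charN posrootN ?weyl_char_root //.
  by rewrite !negbK -/l /=; lia.
have antidom x : dominates x 0 -> pairing x l <= 0.
  move=> dx; rewrite -oppr_ge0 -pairingNr; apply: dom0_pairing_ge0 dx => j.
  by rewrite pairingNr oppr_ge0; apply: le_trans (hs j) _; case: posroot.
have w0 : weyl_char g.2 0 = 0.
  by apply: (addrI (weyl_char g.2 0)); rewrite -weyl_charD !addr0.
(* As [l] is antidominant, it pairs to 0 with each simple root occurring in [x], and by [hs] those
   are kept positive by [g.2]. *)
have flat x : dominates x 0 -> pairing x l = 0 -> dominates (weyl_char g.2 x) 0.
  move=> /dom0P[c ->] x0; rewrite (big_morph _ (weyl_charD g.2) w0).
  elim/big_rec: _ => [|j y _ dy]; first exact: dom00.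
  apply: dom0D => //; rewrite weyl_charMz.
  have [->|cj] := posnP (c j); first exact: dom00.
  apply: dom0Mn; have := hs j; suff -> : pairing (simple j) l = 0.
    by case: posrootP => // -[].
  move: x0; rewrite pairing_suml (bigD1 j) //=; set S := \sum_(_ | _) _.
  have : S <= 0.
    apply: sumr_le0 => k _; rewrite pairingMzl mulr_le0_ge0 //.
    by apply: le_trans (hs k) _; case: posroot.
  rewrite pairingMzl; have := antidom _ (posrootP _ (posroot_simple j)).2.
  by nia.
apply/negP; rewrite -eqn0Ngt; apply/eqP; rewrite big1_seq // => b /andP[_].
rewrite mem_posroots => pb; have [rb db] := posrootP _ pb.
suff -> : offset (g^-1)%g b = 0 by [].
rewrite /offset ext1V ext2V invgK -/l pairingNr.
have db' : dominates (theta - b) 0.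
  by have /dominatesE := dominates_highest D_reduced D_irreducible rb.
have := antidom _ db'; have := antidom _ db; rewrite pairingBl => b0 tb0.
have [bl|bl] := eqVneq (pairing b l) 0.
  suff -> : posroot (weyl_char g.2 b) by rewrite bl.
  by apply/posrootP; split; [exact: weyl_char_root | exact: flat].
(* Here [<theta, l> <= <b, l> < 0]. By [ht] this makes [g.2 theta] negative and both pairings equal
   to -1, so [theta - b] pairs to 0 and [flat] applies to it. *)
have wt : ~~ posroot (weyl_char g.2 theta).
  by apply/negP => p; move: ht; rewrite p /=; lia.
have [tl bl1] : pairing theta l = -1 /\ pairing b l = -1.
  by move: ht bl; case: posroot => /=; lia.
suff -> : posroot (weyl_char g.2 b) = false by rewrite bl1.
apply/negbTE; rewrite -posrootN ?weyl_char_root //; apply/posrootP.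
split; first by rewrite opp_rootE weyl_char_root.
have -> : - weyl_char g.2 b = weyl_char g.2 (theta - b) + - weyl_char g.2 theta.
  by rewrite weyl_charD weyl_charN addrAC subrr add0r.
apply: dom0D; first by apply: flat; rewrite // pairingBl tl bl1.
by move: wt; rewrite -posrootN ?weyl_char_root // => /posrootP[].
Qed.

Lemma ext_weyl_ind (P : ext_weyl D -> Prop) :
  (forall g, elen g = 0%N -> P g) ->
  (forall i g, elen (g * arefl i)%g = (elen g).+1 -> P g -> P (g * arefl i)%g) ->
  forall g, P g.
Proof.
move=> P0 PS g; have [n] := ubnP (elen g); elim: n g => // n IH g gn.
have [g0|g0] := posnP (elen g); first exact: P0.
have [i ei] := elen_descent g0.
rewrite -[g]mulg1 -(arefl2 D_reduced D_irreducible i) mulgA; apply: PS.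
  by rewrite -mulgA arefl2 // mulg1.
by apply: IH; move: gn; rewrite ei.
Qed.
End AffineDescent.

(** * The Hecke algebra *)

Section RingInverse.
Variable A : pzRingType.
Implicit Types x y : A.

Lemma rinv_eq x y : x * y = 1 -> y * x = 1 -> rinv x = y.
Proof.
move=> xy yx; rewrite /rinv; case: xgetP => [z _ [_ zx]|h]; last by case: (h y).
by rewrite -[z]mulr1 -xy mulrA zx mul1r.
Qed.

Lemma mulr_rinv x : invertible x -> x * rinv x = 1.
Proof. by case=> y [xy yx]; rewrite (rinv_eq xy yx). Qed.

Lemma mul_rinvr x : invertible x -> rinv x * x = 1.
Proof. by case=> y [xy yx]; rewrite (rinv_eq xy yx). Qed.

Lemma invertible_rinv x : invertible x -> invertible (rinv x).
Proof. by move=> h; exists x; split; [exact: mul_rinvr | exact: mulr_rinv]. Qed.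

Lemma rinvK x : invertible x -> rinv (rinv x) = x.
Proof. by move=> h; apply: rinv_eq; [exact: mul_rinvr | exact: mulr_rinv]. Qed.

Lemma invertibleM x y : invertible x -> invertible y -> invertible (x * y).
Proof.
move=> hx hy; exists (rinv y * rinv x); split.
  by rewrite mulrA -(mulrA x) mulr_rinv // mulr1 mulr_rinv.
by rewrite mulrA -(mulrA (rinv y)) mul_rinvr // mulr1 mul_rinvr.
Qed.

Lemma mulr_invertibleI x y z : invertible x -> x * y = x * z -> y = z.
Proof. by move=> hx e; rewrite -[y]mul1r -(mul_rinvr hx) -mulrA e mulrA mul_rinvr // mul1r. Qed.

Lemma invertible_mulIr x y z : invertible x -> y * x = z * x -> y = z.
Proof. by move=> hx e; rewrite -[y]mulr1 -(mulr_rinv hx) mulrA e -mulrA mulr_rinv // mulr1. Qed.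
End RingInverse.

Section GroupAlgebraFacts.
Variables (k : comPzRingType) (G : groupType).

Lemma galg_scalerAr (a : k) (f g : galg k G) : a *: (f * g) = f * (a *: g).
Proof.
apply: galg_ext => x; rewrite -[RHS]/(galg_conv f (a *: g)%R x).
rewrite -[LHS]/(a * galg_conv f g x) !(galg_convE _ _ (@galg_suppP _ _ f)) mulr_sumr.
by apply: eq_bigr => y _; rewrite galgZ mulrCA.
Qed.

Lemma galg_deltaM (g h : G) :
  galg_delta k g * galg_delta k h = galg_delta k (g * h)%g.
Proof.
apply: galg_ext => x; rewrite -[LHS]/(galg_conv _ _ x).
rewrite (galg_convE (A := [fset g]%fset)) ?big_seq_fset1 /=.
  by rewrite eqxx mul1r -(inj_eq (mulgI g)) mulVKg.
by move=> y; rewrite inE => /negPf ->.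
Qed.

Variable S : set (galg k G).

Lemma mul_quot_pi x y : quot_pi S x * quot_pi S y = quot_pi S (x * y).
Proof. exact: quot_piM. Qed.

Lemma scale_quot_pi (a : k) x : a *: quot_pi S x = quot_pi S (a *: x).
Proof. exact: quot_piZ. Qed.

Lemma quot_alg_scalerAl (a : k) (x y : quot_alg S) : a *: (x * y) = (a *: x) * y.
Proof.
rewrite -[x]quot_reprK -[y]quot_reprK.
by rewrite !(mul_quot_pi, scale_quot_pi) galg_scalerAl.
Qed.

Lemma quot_alg_scalerAr (a : k) (x y : quot_alg S) : a *: (x * y) = x * (a *: y).
Proof.
rewrite -[x]quot_reprK -[y]quot_reprK.
by rewrite !(mul_quot_pi, scale_quot_pi) galg_scalerAr.
Qed.
End GroupAlgebraFacts.

Section HeckeAlgebra.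
Variables (D : based_root_datum) (k : comPzRingType) (q : k).
Local Notation H := (@hecke D k q).
Implicit Types g h : ext_weyl D.

Lemma hecke_scalerAl (a : k) (x y : H) : a *: (x * y) = (a *: x) * y.
Proof. exact: quot_alg_scalerAl. Qed.

Lemma hecke_scalerAr (a : k) (x y : H) : a *: (x * y) = x * (a *: y).
Proof. exact: quot_alg_scalerAr. Qed.

Lemma hTM g h : elen (g * h)%g = (elen g + elen h)%N ->
  hT q g * hT q h = hT q (g * h)%g.
Proof.
move=> e; rewrite /hT mul_quot_pi /braid_gen galg_deltaM; congr (quot_pi _ (galg_delta k _)).
rewrite [LHS]pres_piM; apply/pres_piP/pres_rel.
by exists g, h.
Qed.

Lemma hT_invertible g : invertible (hT q g : H).
Proof.
exists (quot_pi _ (galg_delta k ((pres_gen (@braid_rel D) g : braid D)^-1)%g)).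
by split; rewrite /hT mul_quot_pi galg_deltaM ?mulgV ?mulVg.
Qed.

Lemma hT_quadratic i : (hT q (arefl i : ext_weyl D) + 1) * (hT q (arefl i) - q *: (1 : H)) = 0.
Proof.
have h : quot_pi (@hecke_rel D k q) ((braid_gen k (arefl i) + 1) *
    (braid_gen k (arefl i) - q *: (1 : galg k (braid D)))) = quot_pi _ 0.
  apply/quot_piP; rewrite subr0 -[X in ideal_gen _ X]addr0 -[X in X + 0]mul1r.
  rewrite -[X in X + 0]mulr1.
  by apply: ideal_genD; [exists i | exact: ideal_gen0].
have e0 : quot_pi (@hecke_rel D k q) 0 = 0.
  by apply: (addrI (quot_pi _ 0)); rewrite -quot_piD !addr0.
rewrite e0 -mul_quot_pi !quot_piD in h; rewrite -[RHS]h; congr (_ * (_ + _)).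
apply: (addrI (q *: (1 : H))); rewrite subrr.
rewrite -[q *: (1 : H)]/(q *: quot_pi (@hecke_rel D k q) 1).
by rewrite scale_quot_pi -quot_piD subrr.
Qed.
End HeckeAlgebra.

(** * Alcove geometry *)

Section RealPairing.
Local Open Scope classical_set_scope.
Local Open Scope ring_scope.
Variables (R : realType) (D : based_root_datum).
Local Notation V := 'rV[R]_(rk D).
Implicit Types (a b x : chars D) (l : cochars D) (w : weyl D) (g h : ext_weyl D).
Implicit Types (y z : V) (t : R).

Lemma rpairingDl a b y : rpairing (a + b) y = rpairing a y + rpairing b y.
Proof.
by rewrite -big_split; apply: eq_bigr => i _; rewrite pairingDl intrD mulrDl.
Qed.

Lemma rpairingDr a y z : rpairing a (y + z) = rpairing a y + rpairing a z.
Proof. by rewrite -big_split; apply: eq_bigr => i _; rewrite mxE mulrDr. Qed.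

Lemma rpairingZr a t y : rpairing a (t *: y) = t * rpairing a y.
Proof. by rewrite mulr_sumr; apply: eq_bigr => i _; rewrite mxE mulrCA. Qed.

Lemma rpairing0r a : rpairing a (0 : V) = 0.
Proof. by rewrite -(scale0r (0 : V)) rpairingZr mul0r. Qed.

Lemma rpairingMzl a (n : int) y : rpairing (a *~ n) y = n%:~R * rpairing a y.
Proof.
rewrite mulr_sumr; apply: eq_bigr => i _.
by rewrite pairingMzl intrM mulrAC mulrC.
Qed.

Lemma rpairingNl a y : rpairing (- a) y = - rpairing a y.
Proof. by rewrite -[a in LHS]mulr1z -mulrNz rpairingMzl mulN1r. Qed.

Lemma rpairing0l y : rpairing (0 : chars D) y = 0.
Proof. by rewrite -(mulr0z 0) rpairingMzl mul0r. Qed.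

Lemma rpairing_suml I (s : seq I) (P : pred I) (F : I -> chars D) y :
  rpairing (\sum_(i <- s | P i) F i) y = \sum_(i <- s | P i) rpairing (F i) y.
Proof.
by rewrite (big_morph (fun x => rpairing x y) (fun a b => rpairingDl a b y)
  (rpairing0l y)).
Qed.

Lemma rpairing_rembed a l : rpairing a (rembed R l) = (pairing a l)%:~R.
Proof.
rewrite {2}(cobasis_span l) pairing_sumr (big_morph _ (@intrD R) (mulr0z _)).
by apply: eq_bigr => i _; rewrite mxE pairingMzr intrM.
Qed.

Lemma rpairing_chbasis i y : rpairing (chbasis i : chars D) y = y 0 i.
Proof.
rewrite /rpairing (bigD1 i) //= pairing_basis eqxx mul1r big1 ?addr0 // => j ji.
by rewrite pairing_basis eq_sym (negPf ji) mul0r.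
Qed.

Lemma rpairing_ext y z : (forall a, rpairing a y = rpairing a z) -> y = z.
Proof. by move=> h; apply/rowP => i; rewrite -!rpairing_chbasis h. Qed.

Lemma rpairing_weyl_act a w y :
  rpairing a (weyl_act w y) = rpairing (weyl_char (w^-1)%g a) y.
Proof.
rewrite /rpairing; under eq_bigr do rewrite mxE mulr_sumr.
rewrite exchange_big; apply: eq_bigr => i _ /=.
under eq_bigr do rewrite mulrA; rewrite -mulr_suml; congr (_ * _).
rewrite pairing_weyl_char invgK {2}(cobasis_span (w (cobasis i))) pairing_sumr.
rewrite (big_morph _ (@intrD R) (mulr0z _)).
by apply: eq_bigr => j _; rewrite pairingMzr intrM.
Qed.

Lemma rpairing_ext_act a g y : rpairing a (ext_act g y) =
  (pairing a g.1)%:~R + rpairing (weyl_char (g.2^-1)%g a) y.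
Proof. by rewrite rpairingDr rpairing_rembed rpairing_weyl_act. Qed.

Lemma ext_actM g h y : ext_act (g * h)%g y = ext_act g (ext_act h y).
Proof.
apply: rpairing_ext => a; rewrite !rpairing_ext_act /= pairingDr intrD -addrA.
rewrite pairing_weyl_char invgK; congr (_ + (_ + _)).
by rewrite invgM weyl_charM.
Qed.

Lemma ext_act1 y : ext_act 1%g y = y.
Proof.
apply: rpairing_ext => a.
by rewrite rpairing_ext_act /= pairing0r add0r invg1 weyl_char1.
Qed.

Lemma ext_act_hyp g a (n : int) :
  ext_act g @` hyp R a n = hyp R (weyl_char g.2 a) (pairing (weyl_char g.2 a) g.1 + n).
Proof.
apply/seteqP; split=> [_ [y ay <-]|y ay].
  by rewrite /hyp /= rpairing_ext_act weyl_charK ay intrD.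
exists (ext_act (g^-1)%g y); last by rewrite -ext_actM mulgV ext_act1.
move: ay; rewrite /hyp /= rpairing_ext_act ext1V ext2V invgK pairingNr.
rewrite -pairing_weyl_char => ->.
by rewrite intrD mulrNz addKr.
Qed.

Lemma hypN a (n : int) : hyp R (- a) n = hyp R a (- n).
Proof.
apply/seteqP; split=> y; rewrite /hyp /= rpairingNl mulrNz.
  by move=> <-; rewrite opprK.
by move=> ->; rewrite opprK.
Qed.

Lemma rembed_inj : injective (rembed R : cochars D -> V).
Proof.
move=> l m h; apply: cochars_ext => x; apply: (@intr_inj R).
by rewrite -!rpairing_rembed h.
Qed.

Lemma rpairing_continuous a : continuous (rpairing a : V -> R).
Proof.
rewrite /rpairing => y; elim: (index_enum _) => [|i s IH].
  have -> : (fun y : V => \sum_(i <- [::]) (pairing a (cobasis i))%:~R * y 0 i) = cst 0.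
    by apply: funext => z; rewrite big_nil.
  exact: cst_continuous.
have -> : (fun y : V => \sum_(i <- i :: s) (pairing a (cobasis i))%:~R * y 0 i)
   = (fun y : V => (pairing a (cobasis i))%:~R * y 0 i) \+
     (fun y : V => \sum_(i <- s) (pairing a (cobasis i))%:~R * y 0 i).
  by apply: funext => z; rewrite big_cons.
apply: continuousD => //; apply: continuousM; first exact: cst_continuous.
exact: coord_continuous.
Qed.

(** The values of [a] on a connected set form an interval, which here omits [r]. *)
Lemma connected_rpairing (A : set V) a (r : R) y z : connected A ->
  (forall p, A p -> rpairing a p != r) -> A y -> A z ->
  rpairing a y < r -> rpairing a z < r.
Proof.
move=> cA hA Ay Az yr; rewrite ltNge; apply/negP => rz.
have cf : {within A, continuous (rpairing a : V -> R)}.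
  exact/continuous_subspaceT/rpairing_continuous.
have /connected_intervalP itv := connected_continuous_connected cA cf.
have [] := itv (rpairing a y) (rpairing a z) _ _ r _.
- by exists y.
- by exists z.
- by rewrite (ltW yr).
by move=> x Ax /eqP; apply/negP; exact: hA.
Qed.
End RealPairing.

(** * The base alcove, its walls and the signs of steps *)

Section AlcoveGeometry.
Local Open Scope classical_set_scope.
Local Open Scope ring_scope.
Variables (R : realType) (D : based_root_datum).
Hypotheses (D_reduced : reduced D) (D_irreducible : irreducible D).
Local Notation V := 'rV[R]_(rk D).
Implicit Types (a b x : chars D) (l : cochars D) (w : weyl D) (g h : ext_weyl D).
Implicit Types (y z p : V) (t : R) (i : 'I_(ssrk D).+1).
Local Notation theta := (highest_root D).
Local Notation wall_root_root := (wall_root_root D_reduced D_irreducible).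

Lemma hyp_compl_neq y a (n : int) : hyp_compl y -> a \in roots D ->
  rpairing a y != n%:~R.
Proof. by move=> hy ha; apply/eqP; exact: hy. Qed.

Lemma unit_box_hyp_compl y :
  (forall a, posroot a -> 0 < rpairing a y < 1) -> hyp_compl y.
Proof.
move=> hy a n ha; have int01 (m : int) : ~ ((0 : R) < m%:~R < 1).
  by rewrite ltr0z -[1]/(1%:~R) ltr_int; lia.
rewrite /hyp /= => e; case: (boolP (posroot a)) => [/hy|].
  by rewrite e; exact: int01.
by rewrite -posrootN // => /hy; rewrite rpairingNl e -mulrNz; exact: int01.
Qed.

(** The height of [theta] bounds all heights, so every positive root lies strictly between 0 and 1
    at this multiple of [2 rho^v]. *)
Definition inner_point : V := (height theta + 1)%:~R^-1 *: rembed R (pos_cosum D).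

Lemma rpairing_inner_point a : posroot a -> 0 < rpairing a inner_point < 1.
Proof.
move=> pa; rewrite rpairingZr rpairing_rembed -/(height a).
have h0 := height_posroot D_reduced pa.
have h1 := dominates_height D_reduced
  (dominates_highest D_reduced D_irreducible (posroot_root pa)).
have c0 : 0 < (height theta + 1)%:~R :> R by rewrite ltr0z; lia.
apply/andP; split; first by rewrite mulr_gt0 ?invr_gt0 // ltr0z.
by rewrite mulrC ltr_pdivrMr // mul1r ltr_int; lia.
Qed.

Lemma connected_scale y s t : connected ((fun u : R => u *: y) @` `[s, t]).
Proof.
apply: connected_continuous_connected.
  exact/connected_intervalP/interval_is_interval.
exact/continuous_subspaceT/scalel_continuous.
Qed.

(** The points [u *: inner_point] with [0 < u <= 1] avoid every root hyperplane, so the origin is in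
    the closure of the component of [inner_point]. Hence [base_alcove] is not the default [set0]. *)
Lemma base_alcove_ex : exists A : set V,
  [/\ alcove A, A `<=` dominant_chamber D R & closure A 0].
Proof.
have c0 : hyp_compl inner_point by exact/unit_box_hyp_compl/rpairing_inner_point.
exists (connected_component (@hyp_compl D R) inner_point); split.
- by exists inner_point.
- move=> y Ay a pa; rewrite -oppr_lt0 -rpairingNl.
  have cA := @component_connected _ (@hyp_compl D R) inner_point.
  apply: (connected_rpairing cA _ (connected_component_refl c0) Ay).
  + move=> p /connected_component_sub hp; rewrite -[0]/(0%:~R).
    by apply: hyp_compl_neq; rewrite ?opp_rootE ?posroot_root.
  + by rewrite rpairingNl oppr_lt0; case/andP: (rpairing_inner_point pa).
move=> B nB.
have cs : {for 0, continuous (fun u : R => u *: inner_point)}.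
  exact: scalel_continuous.
have := cs B; rewrite /= scale0r => /(_ nB) /nbhs_ballP[e e0 he].
pose t := Num.min 1 (e / 2).
have t0 : 0 < t by rewrite lt_min ltr01 divr_gt0.
exists (t *: inner_point); split; last first.
  apply: (he t); rewrite /ball /= sub0r normrN gtr0_norm //.
  have te : t <= e / 2 by rewrite ge_min lexx orbT.
  by move: e0 te => /=; lra.
apply: (@connected_component_max _ _ ((fun u : R => u *: inner_point) @` `[t, 1])).
- by exists 1; rewrite ?scale1r //= in_itv /= lexx andbT ge_min lexx.
- move=> z [u /= + <-]; rewrite in_itv /= => /andP[tu u1].
  apply: unit_box_hyp_compl => a /rpairing_inner_point /andP[a0 a1].
  have u0 : 0 < u by exact: lt_le_trans tu.
  rewrite rpairingZr mulr_gt0 //=; apply: le_lt_trans a1.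
  by rewrite ger_pMl.
- exact: connected_scale.
by exists t => //=; rewrite in_itv /= lexx ge_min lexx.
Qed.

Lemma base_alcove_spec : [/\ alcove (base_alcove D R),
  base_alcove D R `<=` dominant_chamber D R & closure (base_alcove D R) 0].
Proof. exact: (xgetPex set0 base_alcove_ex). Qed.

Lemma base_alcove_nonempty : base_alcove D R !=set0.
Proof.
have [[y hy ->] _ _] := base_alcove_spec.
by exists y; exact: connected_component_refl.
Qed.

Lemma base_alcove_gt0 y a : base_alcove D R y -> posroot a -> 0 < rpairing a y.
Proof. by have [_ h _] := base_alcove_spec => /h; exact. Qed.

(** Near the origin some point of the alcove has [a] below 1, and on the connected alcove [a] never
    takes the value 1. *)
Lemma base_alcove_lt1 y a : base_alcove D R y -> posroot a -> rpairing a y < 1.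
Proof.
have [[y0 hy0 eA] _ cl0] := base_alcove_spec => Ay pa.
have [] := cl0 (rpairing a @^-1` [set u | u < 1]).
  apply: rpairing_continuous; rewrite rpairing0r.
  exact: (@lt_nbhsl _ 0 1 ltr01).
move=> z [Az z1]; apply: (connected_rpairing _ _ Az Ay z1).
  by rewrite eA; exact: component_connected.
move=> p; rewrite eA => /connected_component_sub hp; rewrite -[1]/(1%:~R).
by apply: hyp_compl_neq => //; exact: posroot_root.
Qed.

Lemma rpairing_charefl x a y : rpairing (charefl a x) y =
  rpairing x y - (pairing x (coroot a))%:~R * rpairing a y.
Proof. by rewrite rpairingDl rpairingNl rpairingMzl. Qed.

Lemma fixed_arefl_lift (j : 'I_(ssrk D)) :
  [set y | ext_act (arefl (lift ord0 j)) y = y] = hyp R (simple j : chars D) 0.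
Proof.
have e x y : rpairing x (ext_act (arefl (lift ord0 j)) y) =
    rpairing x y - (pairing x (coroot (simple j)))%:~R * rpairing (simple j) y.
  rewrite rpairing_ext_act arefl_lift /= pairing0r add0r srefl_inv.
  by rewrite weyl_char_srefl rpairing_charefl.
apply/seteqP; split=> y; rewrite /hyp /=; last first.
  by move=> h; apply: rpairing_ext => x; rewrite e h mulr0 subr0.
move=> h; have := e (simple j) y; rewrite h pairing_coroot ?simple_root //.
by move=> h'; change (rpairing (simple j : chars D) y = 0); lra.
Qed.

Lemma fixed_arefl0 : [set y | ext_act (arefl ord0) y = y] = hyp R theta 1.
Proof.
have ht := highest_root_root D_reduced D_irreducible.
have e x y : rpairing x (ext_act (arefl ord0) y) =
    (pairing x (coroot theta))%:~R +
    (rpairing x y - (pairing x (coroot theta))%:~R * rpairing theta y).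
  rewrite rpairing_ext_act arefl0 /= refl_inv //.
  by rewrite weyl_char_refl // rpairing_charefl.
apply/seteqP; split=> y; rewrite /hyp /=; last first.
  move=> h; apply: rpairing_ext => x; rewrite e h mulr1.
  by rewrite addrC subrK.
move=> h; have := e theta y; rewrite h pairing_coroot //.
by move=> h'; change (rpairing theta y = 1); lra.
Qed.

(** On the base alcove simple roots exceed 0 and [theta] stays below 1, so the affine simple roots
    point inward; [g] transports this. *)
Lemma type_wallE i g : exists2 n : int, type_wall i g = hyp R (wall_root i g) n &
  forall y, base_alcove D R y -> n%:~R < rpairing (wall_root i g) (ext_act g y).
Proof.
case: (unliftP ord0 i) => [j|] ->; rewrite /type_wall /wall_root.
  rewrite fixed_arefl_lift ext_act_hyp affine_simple_lift; eexists=> // y Ay.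
  rewrite rpairing_ext_act weyl_charK addr0 ltrDl.
  by apply: base_alcove_gt0 => //; exact: posroot_simple.
rewrite fixed_arefl0 ext_act_hyp affine_simple0 weyl_charN.
exists (- (pairing (weyl_char g.2 theta) g.1 + 1)); first by rewrite hypN opprK.
move=> y Ay; rewrite rpairingNl rpairing_ext_act weyl_charK mulrNz ltrN2 intrD.
rewrite ltrD2l; apply: base_alcove_lt1 => //.
exact: posroot_highest.
Qed.

Lemma step_sign_upward i g : step_sign R i g (upward i g).
Proof.
have [n en hn] := type_wallE i g; have hb := wall_root_root i g.
rewrite /upward; case: (boolP (posroot _)) => pb.
  by exists (wall_root i g), n; split=> // _ [y Ay <-]; exact: hn.
rewrite -posrootN // in pb.
exists (- wall_root i g), (- n); split=> //; first by rewrite hypN opprK.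
by move=> _ [y Ay <-]; rewrite /negside /= rpairingNl mulrNz ltrN2; exact: hn.
Qed.

(** [step_sign] admits any description of the wall by a positive root and a level. Moving from [p]
    along [inner_point] increases both roots and reaches the common hyperplane, so two descriptions
    agree on its sides. *)
Lemma hyp_eq_side a b (n m : int) p : posroot a -> posroot b ->
  hyp R a n = hyp R b m -> rpairing a p < n%:~R -> rpairing b p <= m%:~R.
Proof.
move=> pa pb e hp; rewrite leNgt; apply/negP => hm.
have /andP[a0 _] := rpairing_inner_point pa.
have /andP[b0 _] := rpairing_inner_point pb.
pose t := (n%:~R - rpairing a p) / rpairing a inner_point.
have : hyp R a n (p + t *: inner_point).
  by rewrite /hyp /= rpairingDr rpairingZr /t divfK ?gt_eqF // addrC subrK.
rewrite e /hyp /= rpairingDr rpairingZr => h.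
have t0 : 0 < t by rewrite divr_gt0 ?subr_gt0.
by have := mulr_gt0 t0 b0; lra.
Qed.

Lemma step_sign_unique i g e : step_sign R i g e -> e = upward i g.
Proof.
move=> [a [n [pa ea ha]]]; have [b [m [pb eb hb]]] := step_sign_upward i g.
rewrite ea in eb; have [y Ay] := base_alcove_nonempty.
have gy : (ext_act g @` base_alcove D R) (ext_act g y) by exists y.
have {}ha := ha _ gy; have {}hb := hb _ gy; move: ha hb.
case: e; case: upward => //=; rewrite /negside /posside /=.
  by move=> /(hyp_eq_side pa pb eb); rewrite leNgt => /negP.
by move=> h1 /(hyp_eq_side pb pa (esym eb)); rewrite leNgt h1.
Qed.

Lemma closure_base_alcove_ge0 y a : closure (base_alcove D R) y -> posroot a ->
  0 <= rpairing a y.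
Proof.
move=> cy pa; have cl : closed (rpairing a @^-1` [set u : R | 0 <= u]).
  by apply: closed_comp => [p _|]; [exact: rpairing_continuous | exact: closed_ge].
apply: (cl y); apply: closure_subset cy => p Ap.
exact/ltW/base_alcove_gt0.
Qed.

Lemma closure_base_alcove_le1 y a : closure (base_alcove D R) y -> posroot a ->
  rpairing a y <= 1.
Proof.
move=> cy pa; have cl : closed (rpairing a @^-1` [set u : R | u <= 1]).
  by apply: closed_comp => [p _|]; [exact: rpairing_continuous | exact: closed_le].
apply: (cl y); apply: closure_subset cy => p Ap.
exact/ltW/base_alcove_lt1.
Qed.

(* The difference [theta - phi] vanishes on a relatively open piece of the wall
   [<phi, y> = 1], hence everywhere. *)
Lemma base_alcove_wall phi : posroot phi ->
  is_wall (base_alcove D R) (hyp R phi 1) -> phi = theta.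
Proof.
move=> pphi [_ [y Hy [U Uy sU]]].
have dphi := dominates_highest D_reduced D_irreducible (posroot_root pphi).
pose d := theta - phi.
have d0 z : U z -> hyp R phi 1 z -> rpairing d z = 0.
  move=> Uz Hz; have cz : closure (base_alcove D R) z by exact: sU.
  apply/eqP; rewrite eq_le; apply/andP; split.
    rewrite rpairingDl rpairingNl Hz.
    by rewrite subr_le0 closure_base_alcove_le1 // posroot_highest.
  move/dominatesE: dphi => /dom0P[c ec]; rewrite /d ec rpairing_suml sumr_ge0 // => i _.
  rewrite rpairingMzl mulr_ge0 ?ler0z //.
  by apply: closure_base_alcove_ge0 => //; exact: posroot_simple.
have dz z : rpairing d z = 0.
  (* As [<phi, y> = 1], this direction is killed by [phi]: small moves from [y] along [u] stay in
     the wall and in [U], where [d] vanishes. *)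
  pose u := z - rpairing phi z *: y.
  have cs : {for 0, continuous (fun t : R => y + t *: u)}.
    by apply: continuousD; [exact: cst_continuous | exact: scalel_continuous].
  have := cs U; rewrite /= scale0r addr0 => /(_ Uy) /nbhs_ballP[e e0 he].
  have Ut : U (y + (e / 2) *: u).
    apply: (he (e / 2)); rewrite /ball /= sub0r normrN gtr0_norm ?divr_gt0 //.
    by move: e0 => /=; lra.
  have Uy0 : U y by exact: nbhs_singleton.
  have Hy1 : rpairing phi y = 1 by exact: Hy.
  have lin a : rpairing a (y + (e / 2) *: u) =
      rpairing a y + e / 2 * (rpairing a z - rpairing phi z * rpairing a y).
    by rewrite rpairingDr rpairingZr rpairingDr -scaleNr rpairingZr mulNr.
  have := d0 _ Ut; rewrite /hyp /= !lin (d0 y) // Hy1 mulr1 subrr !mulr0 addr0.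
  rewrite subr0 add0r => /(_ erefl) /eqP.
  by rewrite mulf_eq0 gt_eqF ?divr_gt0 //= => /eqP.
apply/esym/eqP; rewrite -subr_eq0; apply/eqP; apply: chars_ext => l.
by apply: (@intr_inj R); rewrite -rpairing_rembed dz pairing0l.
Qed.
End AlcoveGeometry.

(** * Alcove walks in the Hecke algebra *)

Section NormalizedBasis.
Variables (D : based_root_datum) (k : comPzRingType) (v : k).
Hypotheses (D_reduced : reduced D) (D_irreducible : irreducible D).
Hypothesis v_inv : invertible v.
Local Notation H := (@hecke D k (v ^+ 2)).
Local Notation Q := (v - rinv v).
Implicit Types (g h : ext_weyl D) (i : 'I_(ssrk D).+1).

Lemma nTM g h : elen (g * h)%g = (elen g + elen h)%N ->
  nT v g * nT v h = nT v (g * h)%g.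
Proof.
move=> e; rewrite /nT -hecke_scalerAl -hecke_scalerAr scalerA hTM //.
by rewrite e exprD.
Qed.

Lemma nT_len0 g : elen g = 0%N -> nT v g = hT (v ^+ 2) g.
Proof. by move=> g0; rewrite /nT g0 scale1r. Qed.

Lemma nT_invertible g : invertible (nT v g : H).
Proof.
have [y [xy yx]] := @hT_invertible D k (v ^+ 2) g.
have vv n : v ^+ n * rinv v ^+ n = 1 by rewrite -exprMn mulr_rinv ?expr1n.
exists (v ^+ elen g *: y); rewrite /nT.
split; rewrite -hecke_scalerAl -hecke_scalerAr scalerA.
  by rewrite mulrC vv scale1r.
by rewrite vv scale1r.
Qed.

Lemma nT_arefl2 i :
  nT v (arefl i) * nT v (arefl i) = Q *: nT v (arefl i) + 1 :> H.
Proof.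
have vv : v * rinv v = 1 by exact: mulr_rinv.
rewrite /nT elen_arefl // expr1 -hecke_scalerAl -hecke_scalerAr !scalerA.
set T := hT _ _; have : T * T = (v ^+ 2) *: T - T + v ^+ 2 *: (1 : H).
  have := @hT_quadratic D k (v ^+ 2) i; rewrite -/T mulrDl !mulrBr !mul1r.
  rewrite -hecke_scalerAr mulr1 -addrA => /eqP; rewrite addr_eq0 => /eqP ->.
  by rewrite !opprD !opprK addrA.
move=> ->; rewrite scalerDr scalerBr !scalerA.
have e1 : rinv v * rinv v * v ^+ 2 = 1.
  by rewrite expr2 mulrACA [rinv v * v]mulrC vv mulr1.
by rewrite e1 !scale1r mulrBl vv scalerBl scale1r.
Qed.

Lemma rinv_nT_arefl i : rinv (nT v (arefl i)) = nT v (arefl i) - Q *: (1 : H).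
Proof.
apply: rinv_eq.
  by rewrite mulrBr nT_arefl2 -hecke_scalerAr mulr1 addrAC subrr add0r.
by rewrite mulrBl nT_arefl2 -hecke_scalerAl mul1r addrAC subrr add0r.
Qed.

Lemma upward_translM i l g : upward i (transl l * g)%g = upward i g.
Proof. by rewrite /upward /wall_root /= mul1g. Qed.

(** Where the offset is positive, going up lengthens and going down shortens; strictness keeps a
    downward step at offset at least 0. *)
Lemma nT_step i g : 0 < offset g (absroot (wall_root i g)) ->
  nT v g * Phi_step v (i, upward i g) = nT v (g * arefl i)%g :> H.
Proof.
move=> pos; rewrite /Phi_step /=; case: (boolP (upward i g)) => up.
  by rewrite nTM // elen_arefl // addn1 elen_step_up // ltW.
have gss : (g * arefl i * arefl i = g)%g by rewrite -mulgA arefl2 // mulg1.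
have e : nT v (g * arefl i)%g * nT v (arefl i) = nT v g :> H.
  by rewrite nTM gss // elen_arefl // addn1; exact: elen_step_down.
by rewrite -e -mulrA mulr_rinv ?mulr1 //; exact: nT_invertible.
Qed.
End NormalizedBasis.

(** * Images of walks, and multiplicativity of [theta] *)

Section Walks.
Variables (R : realType) (D : based_root_datum) (k : comPzRingType) (v : k).
Hypotheses (D_reduced : reduced D) (D_irreducible : irreducible D).
Hypothesis v_inv : invertible v.
Local Notation H := (@hecke D k (v ^+ 2)).
Local Notation Q := (v - rinv v).
Implicit Types (g h : ext_weyl D) (i : 'I_(ssrk D).+1) (l m : cochars D).
Implicit Types (a : chars D) (w : weyl D) (j : 'I_(ssrk D)).

Definition deep (n : nat) : ext_weyl D := transl (pos_cosum D *+ n).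

Lemma pairing_deep a n : posroot a -> n%:Z <= pairing a (pos_cosum D *+ n).
Proof.
move=> /(height_posroot D_reduced); rewrite /height pairingMnr => h.
by rewrite -mulr_natr natz; nia.
Qed.

(** The threshold exceeds the offsets met along the walk, so [nT_step] applies to every translated
    step. All larger [n] are covered because different walks must be compared at a common [n]. *)
Lemma nonfolded_deep g (s : seq ('I_(ssrk D).+1 * bool)) h :
    steps_from R g s -> elen h = 0%N ->
  exists N, forall n, (N <= n)%N ->
    nT v (deep n * g)%g * Phi v (s, h) = nT v (deep n * (g * endpoint (s, h)))%g.
Proof.
move=> + h0; elim: s g => [|[i e] s IH] g /=.
  move=> _; exists 0%N => n _; rewrite /Phi big_nil mul1r /endpoint /=.
  rewrite -nT_len0 // nTM; first by rewrite -mulgA.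
  by rewrite elen_mulr_len0 // h0 addn0.
move=> [/(step_sign_unique D_reduced D_irreducible) -> /IH[N hN]].
set a := absroot (wall_root i g).
have pa : posroot a by exact/absroot_pos/wall_root_root.
exists (maxn N (`|offset g a|).+1) => n; rewrite geq_max => /andP[nN na].
have -> : Phi v ((i, upward i g) :: s, h) =
    Phi_step v (i, upward i g) * Phi v (s, h) by rewrite /Phi big_cons mulrA.
rewrite mulrA -(upward_translM i (pos_cosum D *+ n)) nT_step //; last first.
  have -> : wall_root i (deep n * g)%g = wall_root i g by rewrite /wall_root /= mul1g.
  rewrite offset_translM; have := pairing_deep n pa; rewrite -/a.
  by move: na; lia.
by rewrite -mulgA hN // !mulgA.
Qed.

Lemma nonfolded_walk_ex g : exists p, nonfolded R p /\ endpoint p = g.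
Proof.
have [t [h [h0 eh]]] : exists t h, elen h = 0%N /\
    g = foldr (fun i g => arefl i * g)%g h t.
  (* Walks carry their length zero factor on the right, while [ext_weyl_ind] starts from it on the
     left; hence the inverse. *)
  rewrite -[g]invgK; move: (g^-1)%g.
  apply: (ext_weyl_ind D_reduced D_irreducible) => [f f0|i f _ [t [h [h0 eh]]]].
    by exists [::], (f^-1)%g; rewrite elenV.
  exists (i :: t), h; split=> //=; rewrite -eh invgM; congr (_ * _)%g.
  by apply: (mulgI (arefl i)); rewrite mulgV arefl2.
have [s [hs es]] : exists s, steps_from R 1%g s /\ endpoint (s, h) = g.
  rewrite {}eh; move: (1%g); elim: t => [|i t IH] f; first by exists [::].
  have [s [hs es]] := IH (f * arefl i)%g.
  exists ((i, upward i f) :: s); split; last by rewrite /endpoint /= -es.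
  by split=> //; exact: step_sign_upward.
by exists (s, h).
Qed.

Definition walkT g : H := Phi v (walk_to R g).

Lemma walkTP g : exists N, forall n, (N <= n)%N ->
  nT v (deep n) * walkT g = nT v (deep n * g)%g.
Proof.
have [] := xgetPex ([::], 1%g) (nonfolded_walk_ex g).
rewrite -/(walk_to R g) /walkT; case: (walk_to R g) => s h [hs h0] eg.
have [N hN] := nonfolded_deep hs h0; exists N => n /hN.
by rewrite mulg1 mul1g eg.
Qed.

(** As [nT v (deep n)] is invertible, one [n] above both thresholds determines the element. This is
    the independence of the walk. *)
Lemma walkT_unique g (x : H) N :
  (forall n, (N <= n)%N -> nT v (deep n) * x = nT v (deep n * g)%g) -> x = walkT g.
Proof.
move=> hx; have [M hM] := walkTP g; pose n := maxn N M.
apply: (mulr_invertibleI (nT_invertible v_inv (deep n))).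
by rewrite hx ?leq_maxl // hM ?leq_maxr.
Qed.

Lemma walkT_invertible g : invertible (walkT g).
Proof.
have [N /(_ N (leqnn N)) hN] := walkTP g.
have h := nT_invertible v_inv (deep N).
have -> : walkT g = rinv (nT v (deep N)) * nT v (deep N * g)%g.
  by rewrite -hN mulrA mul_rinvr // mul1r.
by apply: invertibleM; [exact: invertible_rinv | exact: nT_invertible].
Qed.

(** This rule replaces explicit walks below: one may continue by a step from any end point. *)
Lemma walkT_step i g :
  walkT g * Phi_step v (i, upward i g) = walkT (g * arefl i)%g.
Proof.
have [N hN] := walkTP g; set a := absroot (wall_root i g).
have pa : posroot a by exact/absroot_pos/wall_root_root.
apply: (@walkT_unique _ _ (maxn N (`|offset g a|).+1)) => n.
rewrite geq_max => /andP[nN na]; rewrite mulrA hN //.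
rewrite -(upward_translM i (pos_cosum D *+ n)) nT_step ?mulgA //.
have -> : wall_root i (deep n * g)%g = wall_root i g by rewrite /wall_root /= mul1g.
rewrite offset_translM; have := pairing_deep n pa; rewrite -/a.
by move: na; lia.
Qed.

Lemma walkT_mulr_len0 g h : elen h = 0%N ->
  walkT (g * h)%g = walkT g * hT (v ^+ 2) h.
Proof.
move=> h0; have [N hN] := walkTP g; apply/esym.
apply: (@walkT_unique _ _ N) => n nN; rewrite mulrA hN // -nT_len0 // nTM ?mulgA //.
by rewrite elen_mulr_len0 // h0 addn0.
Qed.

Lemma walkT1 : walkT 1%g = 1.
Proof. by apply/esym/(@walkT_unique _ _ 0%N) => n _; rewrite mulr1 mulg1. Qed.

Lemma walkT_len0 h : elen h = 0%N -> walkT h = hT (v ^+ 2) h.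
Proof. by move=> h0; rewrite -[h in LHS]mul1g walkT_mulr_len0 // walkT1 mul1r. Qed.

Lemma dominant_deep n : dominant (pos_cosum D *+ n).
Proof. by move=> j; apply: le_trans (pairing_deep n (posroot_simple j)). Qed.

Lemma theta_dominant l : dominant l -> theta R v l = nT v (transl l).
Proof.
move=> dl; apply/esym/(@walkT_unique _ _ 0%N) => n _.
by rewrite nTM // elen_translD //; exact: dominant_deep.
Qed.

(** The walk behind [tfin] ends at [w^-1]. For [m] a positive multiple of [pos_cosum], the lengths
    of [eps^m w^-1] and [w] add up to that of [eps^m], so the image of the walk is inverse to
    [nT v (of_weyl w)]. *)
Lemma tfinE w : tfin R v w = nT v (of_weyl w).
Proof.
have hw := nT_invertible v_inv (of_weyl w).
rewrite /tfin -/(walkT _) -(@walkT_unique _ (rinv (nT v (of_weyl w))) 1%N).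
  by rewrite rinvK.
move=> n n1; apply: (invertible_mulIr hw).
rewrite -mulrA mul_rinvr // mulr1 nTM -mulgA -of_weylM mulVg mulg1 //.
rewrite [LHS](elen_transl_weyl (w^-1)%g) ?invgK // => a pa.
by have := pairing_deep n pa; lia.
Qed.

Lemma thetaD l m : theta R v l * theta R v m = theta R v (l + m).
Proof.
have [N1 h1] := walkTP (transl l); have [N2 h2] := walkTP (transl m).
have [N3 h3] := walkTP (transl (l + m)).
(* [c l'] bounds every [|<alpha_j, l'>|], so adding [n >= c l'] copies of [pos_cosum] makes [l']
   dominant. *)
pose c l' := (\sum_(a <- posroots D) `|pairing a l'|)%N.
have dom n l' : (c l' <= n)%N -> dominant (pos_cosum D *+ n + l').
  move=> cn j; rewrite pairingDr.
  have := pairing_deep n (posroot_simple j).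
  have : (`|pairing (simple j) l'| <= c l')%N.
    have mj : simple j \in posroots D by rewrite mem_posroots posroot_simple.
    by rewrite /c (big_rem (simple j)) //= leq_addr.
  by move: cn; lia.
pose n := (N1 + N2 + N3 + c l + c m + c (l + m)%R)%N.
have dl : dominant (pos_cosum D *+ n + l) by apply: dom; rewrite /n; lia.
have dm : dominant (pos_cosum D *+ n + m) by apply: dom; rewrite /n; lia.
have nTD l1 l2 : dominant l1 -> dominant l2 ->
    nT v (transl l1) * nT v (transl l2) = nT v (transl (l1 + l2)) :> H.
  by move=> d1 d2; rewrite nTM; [rewrite translD | exact: elen_translD].
have dn := dominant_deep n.
have hn := nT_invertible v_inv (deep n).
pose K := pos_cosum D *+ n.
have el : nT v (deep n) * theta R v l = nT v (transl (K + l)).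
  by rewrite h1 /deep ?translD //; rewrite /n; lia.
have em : nT v (deep n) * theta R v m = nT v (transl (K + m)).
  by rewrite h2 /deep ?translD //; rewrite /n; lia.
have elm : nT v (deep n) * theta R v (l + m) = nT v (transl (K + (l + m))).
  by rewrite h3 /deep ?translD //; rewrite /n; lia.
have dlm : dominant (K + (l + m)) by apply: dom; rewrite /n; lia.
(* Two copies of the translation are needed: one absorbs [theta_l], the other commutes past the
   result and absorbs [theta_m]. *)
apply: (mulr_invertibleI (invertibleM hn hn)).
move: el em elm; move: (theta R v l) (theta R v m) (theta R v (l + m)).
move=> A B C el em elm; rewrite -[RHS]mulrA elm -[LHS]mulrA (mulrA _ A) el.
rewrite (nTD K (K + _)) // mulrA (nTD K (K + l)) // (addrC K (K + l)) -(nTD _ K) //.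
rewrite -mulrA em nTD //.
by congr (nT v (transl _)); rewrite -!addrA; congr (_ + _); rewrite addrCA.
Qed.
End Walks.

(** * Bernstein relations *)

Section HeckeIdentities.
Variables (D : based_root_datum) (k : comPzRingType) (v : k).
Local Notation H := (@hecke D k (v ^+ 2)).
Local Notation Q := (v - rinv v).

(** The inverse of [W = A Y] is [X B]; multiplying [W^2 = Q W + 1] by it gives [W = Q + X B]. In the
    application [X] is [T] with inverse [Y], and [A], [B] are [theta] of the coroot and of its
    negative. *)
Lemma hecke_corootN_of_quadratic (X Y A B : H) :
  Y * X = 1 -> Y = X - Q *: (1 : H) -> A * B = 1 ->
  (A * Y) * (A * Y) = Q *: (A * Y) + 1 -> X * B = A * X - Q *: (A + 1).
Proof.
move=> YX eY AB W2; have W1 : A * Y * (X * B) = 1.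
  by rewrite mulrA -(mulrA A) YX mulr1.
have := congr1 (fun Z => Z * (X * B)) W2.
rewrite -mulrA W1 mulr1 mulrDl -hecke_scalerAl W1 mul1r => e.
apply: (addrI (Q *: (1 : H))); rewrite -e eY mulrBr -hecke_scalerAr mulr1.
by rewrite scalerDr opprD [RHS]addrC !addrA subrK.
Qed.

Lemma hecke_coroot_of_corootN (X A B : H) : B * A = 1 ->
  X * B = A * X - Q *: (A + 1) -> X * A = B * X + Q *: (A + 1).
Proof.
move=> BA e; have := congr1 (fun Z => B * Z * A) e.
rewrite mulrBr (mulrA B A) BA mul1r mulrBl -hecke_scalerAr -hecke_scalerAl.
rewrite mulrDr BA mulr1 mulrDl mul1r BA mulrA -(mulrA _ B) BA mulr1 => ->.
by rewrite subrK.
Qed.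
End HeckeIdentities.

(** * The Bernstein relation for a simple reflection *)

Section Bernstein.
Variables (R : realType) (D : based_root_datum) (k : comPzRingType) (v : k).
Hypotheses (D_reduced : reduced D) (D_irreducible : irreducible D).
Hypothesis v_inv : invertible v.
Local Notation H := (@hecke D k (v ^+ 2)).
Local Notation Q := (v - rinv v).
Local Notation walkT := (@walkT R D k v).
Local Notation theta := (@theta D R k v).
Implicit Types (g h x : ext_weyl D) (i : 'I_(ssrk D).+1) (l m : cochars D).
Implicit Types (a b : chars D) (w : weyl D).
Variable j : 'I_(ssrk D).
Local Notation alpha := (simple j : chars D).
Local Notation T := (nT v (of_weyl (srefl j)) : H).

Lemma walkT_arefl i g :
  walkT (g * arefl i)%g = walkT g * Phi_step v (i, upward i g).
Proof. by rewrite walkT_step. Qed.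

Lemma posroot_charefl_simple b : b \in roots D -> absroot b != alpha ->
  posroot (charefl alpha b) = posroot b.
Proof.
rewrite /absroot => hb; case: (boolP (posroot b)) => pb ne.
  exact: charefl_simple_pos.
rewrite -posrootN // in pb; have := charefl_simple_pos D_reduced pb ne.
rewrite -!weyl_char_srefl weyl_charN posrootN ?weyl_char_root //.
exact: negbTE.
Qed.

(* The reflection [h] maps an alcove walk staying in the strip [0 < alpha < 1]
   to a walk with the same signs, since [srefl j] permutes the positive roots
   other than [alpha]. *)
Lemma walkT_mirror h x : h.2 = srefl j -> offset x alpha = 0 ->
  walkT (h * x)%g = walkT h * walkT x.
Proof.
move=> h2; elim/(ext_weyl_ind D_reduced D_irreducible): x => [x x0 _|i x elx IH].
  by rewrite walkT_mulr_len0 // [walkT x]walkT_len0.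
have rb := wall_root_root D_reduced D_irreducible i x.
(* Entering the strip across a bounding wall would take the offset at [alpha] from 1 or -1 to 0 and
   shorten the element, against [elx]. So the reduced walk never leaves the strip. *)
have [e|ne] := eqVneq alpha (absroot (wall_root i x)).
  have := elen_step D_reduced D_irreducible i x.
  rewrite e offset_step_eq // => h0 e0; move: h0; rewrite elx e0.
  by move: (elen x) => n; lia.
rewrite offset_step_neq ?posroot_simple // => /IH e.
rewrite mulgA (walkT_arefl i (h * x)%g) e (walkT_arefl i x) mulrA.
congr (_ * Phi_step v (_, _)).
rewrite /upward /wall_root /= h2 weyl_charM weyl_char_srefl.
by rewrite posroot_charefl_simple // eq_sym.
Qed.

Lemma rinvT : rinv T = T - Q *: (1 : H).
Proof. by rewrite -arefl_lift rinv_nT_arefl. Qed.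

Lemma T_invertible : invertible T.
Proof. exact: nT_invertible. Qed.

Lemma walkT_srefl_down g : posroot (weyl_char g.2 alpha) ->
  walkT (g * of_weyl (srefl j))%g = walkT g * rinv T.
Proof.
move=> p; rewrite -arefl_lift walkT_arefl /upward /wall_root.
by rewrite affine_simple_lift p /Phi_step /= arefl_lift.
Qed.

Lemma walkT_srefl : walkT (of_weyl (srefl j)) = rinv T.
Proof.
rewrite -[in LHS](mul1g (of_weyl _)) walkT_srefl_down ?walkT1 ?mul1r //.
by rewrite /= weyl_char1 posroot_simple.
Qed.

Lemma srefl_transl l :
  (of_weyl (srefl j) * transl l = transl (srefl j l) * of_weyl (srefl j))%g.
Proof.
congr pair; last by rewrite mulg1 mul1g.
by rewrite /= add0r; apply/esym/addr0.
Qed.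

Lemma walkT_transl_srefl l :
  walkT (transl l * of_weyl (srefl j))%g = theta l * rinv T.
Proof. by rewrite walkT_srefl_down //= weyl_char1 posroot_simple. Qed.

Lemma pairing_alphav : pairing alpha (coroot alpha) = 2.
Proof. by rewrite pairing_coroot ?simple_root. Qed.

Definition bernstein l :=
  T * theta l = theta (srefl j l) * T + Q *: bernstein_frac R v alpha l.

Lemma bernstein_frac_ge0 l (n : nat) : pairing alpha l = n%:Z ->
  bernstein_frac R v alpha l = \sum_(0 <= m < n) theta (l - coroot alpha *+ m).
Proof. by rewrite /bernstein_frac => ->. Qed.

Lemma bernstein_frac_lt0 l (n : nat) : pairing alpha l = Negz n ->
  bernstein_frac R v alpha l = - \sum_(1 <= m < n.+2) theta (l + coroot alpha *+ m).
Proof. by rewrite /bernstein_frac => ->. Qed.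

(** Here [eps^l] lies in the strip and commutes with [s_j], so by mirroring [theta_l] commutes with
    [T]. *)
Lemma bernstein0 l : pairing alpha l = 0 -> bernstein l.
Proof.
move=> l0; have sl : srefl j l = l by rewrite /= /corefl l0 mulr0z subr0.
rewrite /bernstein sl (bernstein_frac_ge0 l0) big_geq // scaler0 addr0.
have e : rinv T * theta l = theta l * rinv T.
  rewrite -walkT_srefl -walkT_mirror //; last first.
    by rewrite offset_transl ?posroot_simple.
  by rewrite srefl_transl sl walkT_transl_srefl walkT_srefl.
have hT := T_invertible.
apply: (invertible_mulIr (invertible_rinv hT)).
by rewrite -mulrA -e mulrA mulr_rinv // mul1r -mulrA mulr_rinv // mulr1.
Qed.

(** Now [eps^l s_j] lies in the strip, with mirror image [eps^(s_j l)] under [s_j]. Hence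
    [theta_(s_j l) = T^-1 theta_l T^-1]; expand the left [T^-1]. *)
Lemma bernstein1 l : pairing alpha l = 1 -> bernstein l.
Proof.
move=> l1; have hT := T_invertible.
have e : theta (srefl j l) = rinv T * (theta l * rinv T).
  rewrite -walkT_transl_srefl -walkT_srefl -walkT_mirror //.
    rewrite mulgA srefl_transl -mulgA -of_weylM srefl2.
    by rewrite (_ : of_weyl 1%g = 1%g) // mulg1.
  rewrite offset_translM l1 offset_of_weyl srefl_inv weyl_char_srefl.
  by rewrite charefl_self ?simple_root // negroot_simple.
rewrite /bernstein e -!mulrA mul_rinvr // mulr1 rinvT mulrBl.
rewrite -(hecke_scalerAl _ 1) mul1r (bernstein_frac_ge0 l1) big_nat1 mulr0n subr0.
by rewrite subrK.
Qed.

(** The offset at [alpha] starts at 0 and changes by at most one per step, so a walk to [g] passes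
    from 0 to 1 somewhere. *)
Lemma strip_exit g : 1 <= offset g alpha -> exists x i,
  [/\ offset x alpha = 0, upward i x & wall_root i x = - alpha].
Proof.
elim/(ext_weyl_ind D_reduced D_irreducible): g => [g g0|i g _ IH].
  by rewrite elen_eq0_offset ?simple_root // offset1_pos ?posroot_simple.
have [e|ne] := eqVneq alpha (absroot (wall_root i g)); last first.
  by rewrite offset_step_neq ?posroot_simple.
have [/IH //|lt1] := leP 1 (offset g alpha).
have := offset_step_eq D_reduced D_irreducible i g; rewrite -e => ->.
case: (boolP (upward i g)) => up h; last by lia.
exists g, i; split=> //; first by lia.
by rewrite e /absroot; move: up; rewrite /upward => /negPf ->; rewrite opprK.
Qed.

(** The reflection in the wall [<alpha, y> = 1]. *)
Local Notation r := (transl (coroot alpha) * of_weyl (srefl j))%g.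

(** The hypotheses say that the wall of type [i] of [x] is [<alpha, y> = 1]. The reflection in it
    acts as [r] from the left and as [arefl i] from the right. *)
Lemma wall_reflection x i : offset x alpha = 0 -> wall_root i x = - alpha ->
  (r * x = x * arefl i)%g.
Proof.
move=> x0 ex; have aE : alpha = - wall_root i x by rewrite ex opprK.
have re : r = (coroot alpha, srefl j) by congr pair; [exact: addr0 | exact: mul1g].
have ra := simple_root j.
have refl_i b : b \in roots D -> weyl_char x.2 b = alpha \/ weyl_char x.2 b = - alpha ->
    (srefl j * x.2 = x.2 * refl b)%g.
  move=> rb hb; suff -> : srefl j = (x.2 * refl b * x.2^-1)%g.
    by rewrite -!mulgA mulVg mulg1.
  rewrite -refl_weyl_char //; apply: weyl_ext => l.
  rewrite refl_root ?weyl_char_root //.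
  by case: hb => -> //; rewrite /corefl corootN // pairingNl mulrNz mulNrz opprK.
rewrite re; move: x0; rewrite /offset.
case: (unliftP ord0 i) ex => [i'|] -> ex; rewrite /wall_root in ex.
  rewrite affine_simple_lift in ex; rewrite arefl_lift.
  have -> : weyl_char (x.2^-1)%g alpha = - simple i'.
    by apply: (can_inj (weyl_charK x.2)); rewrite weyl_charVK weyl_charN ex opprK.
  rewrite negroot_simple /= => h; have l1 : pairing alpha x.1 = 1 by lia.
  congr pair; rewrite /= ?weyl0 ?addr0 /corefl ?l1 ?mulr1z.
    by rewrite addrC subrK.
  by rewrite (refl_i (simple i')) ?simple_root ?refl_simple //; right.
rewrite affine_simple0 in ex; rewrite arefl0.
have et : weyl_char x.2 (highest_root D) = alpha.
  by rewrite -[LHS]opprK -weyl_charN ex opprK.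
have -> : weyl_char (x.2^-1)%g alpha = highest_root D.
  by rewrite -et weyl_charK.
rewrite posroot_highest //= subr0 => l0.
have rt := highest_root_root D_reduced D_irreducible.
congr pair; rewrite /= /corefl ?l0 ?mulr0z ?subr0.
  by rewrite -coroot_weyl_char // et addrC.
by rewrite (refl_i (highest_root D)) //; left.
Qed.

Lemma walkT_r : walkT r * walkT r = Q *: walkT r + 1.
Proof.
(* Translation by [alpha^v] has offset 2 at [alpha], so it lies beyond the wall. *)
have [|x [i [x0 up ex]]] := @strip_exit (transl (coroot alpha)).
  by rewrite offset_transl ?posroot_simple // pairing_alphav.
have e : walkT r * walkT x = walkT x * nT v (arefl i).
  rewrite -walkT_mirror //=; last exact: mul1g.
  by rewrite (wall_reflection x0 ex) walkT_arefl up.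
apply: (invertible_mulIr (walkT_invertible R D_reduced D_irreducible v_inv x)).
rewrite -mulrA e mulrA e -mulrA nT_arefl2 // mulrDr mulr1 mulrDl mul1r.
by rewrite -hecke_scalerAr -hecke_scalerAl e.
Qed.

Lemma theta0 : theta 0 = 1.
Proof. exact: walkT1. Qed.

Lemma thetaE l m : theta (l + m) = theta l * theta m.
Proof. by rewrite thetaD. Qed.

Lemma T_theta_corootN : T * theta (- coroot alpha) =
  theta (coroot alpha) * T - Q *: (theta (coroot alpha) + 1).
Proof.
apply: (hecke_corootN_of_quadratic (mul_rinvr T_invertible) rinvT).
  by rewrite thetaD // subrr theta0.
by have := walkT_r; rewrite walkT_transl_srefl.
Qed.

Lemma T_theta_coroot : T * theta (coroot alpha) =
  theta (- coroot alpha) * T + Q *: (theta (coroot alpha) + 1).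
Proof.
apply: hecke_coroot_of_corootN T_theta_corootN.
by rewrite thetaD // addNr theta0.
Qed.

Lemma srefl_corootD l : srefl j (l + coroot alpha) = srefl j l - coroot alpha.
Proof. by rewrite weylD; congr (_ + _); exact/corefl_coroot/simple_root. Qed.

(** With [A = theta_(alpha^v)], the new fraction exceeds [A] times the old one by
    [theta_(s_j l) (A - A^-1) / (1 - A^-1)], and this last quotient is [A + 1]. *)
Lemma bernstein_frac_step l : bernstein_frac R v alpha (l + coroot alpha) =
  bernstein_frac R v alpha l * theta (coroot alpha) +
  theta (srefl j l) * (theta (coroot alpha) + 1).
Proof.
have sE : srefl j l = l - coroot alpha *~ pairing alpha l by [].
have pE : pairing alpha (l + coroot alpha) = pairing alpha l + 2.
  by rewrite pairingDr pairing_alphav.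
rewrite mulrDr mulr1 thetaD //; case en : (pairing alpha l) => [n|n].
  rewrite (bernstein_frac_ge0 en) (@bernstein_frac_ge0 _ n.+2); last first.
    by rewrite pE en; lia.
  rewrite sE en !big_nat_recr //= mulr_suml -!addrA; congr (_ + (theta _ + theta _)).
  - by apply: eq_bigr => m _; rewrite thetaD // addrAC.
  - by congr (_ + _); rewrite addrC.
  - by congr (_ + _); rewrite mulrS opprD addNKr.
have sE' : srefl j l = l + coroot alpha *+ n.+1 by rewrite sE en NegzE mulrNz opprK.
rewrite (bernstein_frac_lt0 en) mulNr mulr_suml sE'.
have tE (m : nat) : theta (l + coroot alpha *+ m) * theta (coroot alpha) =
    theta (l + coroot alpha *+ m.+1).
  by rewrite thetaD // mulrSr addrA.
(* Pairings -1 and -2 become 1 and 0, where [bernstein_frac] switches to its nonnegative branch. *)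
case: n en sE' => [|[|n]] en sE'.
- rewrite (@bernstein_frac_ge0 _ 1%N); last by rewrite pE en.
  by rewrite !big_nat1 tE mulr0n subr0 -(addrA l) -mulrSr addKr.
- rewrite (@bernstein_frac_ge0 _ 0%N); last by rewrite pE en.
  rewrite big_geq // big_nat_recr //= big_nat1 !tE -(addrA l) -mulrSr.
  by rewrite [X in - X + _]addrC addNr.
rewrite (@bernstein_frac_lt0 _ n); last by rewrite pE en; lia.
have -> : \sum_(1 <= m < n.+4) theta (l + coroot alpha *+ m) * theta (coroot alpha) =
    \sum_(1 <= m < n.+2) theta (l + coroot alpha + coroot alpha *+ m) +
    (theta (l + coroot alpha *+ n.+3) + theta (l + coroot alpha *+ n.+4)).
  rewrite big_nat_recr //= big_nat_recr //= !tE [RHS]addrA; congr (_ + _ + _).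
  by apply: eq_bigr => m _; rewrite tE -(addrA l) -mulrS.
rewrite -(addrA l (coroot alpha *+ n.+3)) -mulrSr [in RHS]opprD -addrA.
by rewrite [X in _ = _ + (_ + X)]addrC addNr addr0.
Qed.

(** Multiply on the right by [theta] of the coroot or of its negative, and move it past [T] by the
    two relations above. *)
Lemma bernstein_coroot l : bernstein l <-> bernstein (l + coroot alpha).
Proof.
rewrite /bernstein srefl_corootD bernstein_frac_step.
rewrite (thetaE l) (thetaE (srefl j l)).
have := T_theta_coroot; have := T_theta_corootN.
have AB : theta (coroot alpha) * theta (- coroot alpha) = 1.
  by rewrite thetaD // subrr theta0.
have BA : theta (- coroot alpha) * theta (coroot alpha) = 1.
  by rewrite thetaD // addNr theta0.
move: AB BA; move: (theta (coroot alpha)) (theta (- coroot alpha)) (theta l)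
  (theta (srefl j l)) (bernstein_frac _ _ _ _) T => A B X Y F S AB BA eB eA.
have scAl := @hecke_scalerAl D k (v ^+ 2); have scAr := @hecke_scalerAr D k (v ^+ 2).
split=> [e|e].
  rewrite mulrA e mulrDl -(mulrA Y S) eA mulrDr -scAl -scAr [F * A + _]addrC.
  by rewrite scalerDr !addrA !mulrA.
have : S * (X * A) * B = (Y * B * S + Q *: (F * A + Y * (A + 1))) * B by rewrite e.
rewrite -!(mulrA S) -(mulrA X) AB mulr1 mulrDl -(mulrA _ S) eB -scAl => ->.
rewrite mulrBr -scAr (mulrA _ A) -(mulrA Y B A) BA mulr1.
rewrite -(mulrA Y B) (mulrDr B) BA mulr1 (mulrDl (F * A)) -(mulrA F) AB mulr1.
rewrite -(mulrA Y) (mulrDl A) AB mul1r scalerDr [Q *: F + _]addrC addrA subrK //.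
Qed.

Lemma bernsteinP l : bernstein l.
Proof.
have up (n : nat) m : bernstein m <-> bernstein (m + coroot alpha *+ n).
  elim: n => [|n IH]; first by rewrite mulr0n addr0.
  by rewrite mulrSr addrA -bernstein_coroot.
have shift (n : int) m : bernstein m <-> bernstein (m + coroot alpha *~ n).
  case: n => n; first exact: up.
  by rewrite NegzE mulrNz (up n.+1 (m - _)) subrK.
(* Each shift by the coroot changes the pairing by 2, so only its parity [e] remains. *)
pose e := (pairing alpha l %% 2)%Z; pose d := (pairing alpha l %/ 2)%Z.
rewrite -[l](subrK (coroot alpha *~ d)) -shift.
have pe : pairing alpha (l - coroot alpha *~ d) = e.
  rewrite pairingBr pairingMzr pairing_alphav {1}(divz_eq (pairing alpha l) 2).
  by rewrite -/d -/e; lia.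
have [e0|e1] : e = 0 \/ e = 1.
  have := ltz_pmod (pairing alpha l) (isT : 0 < 2 :> int).
  by have := modz_ge0 (pairing alpha l) (isT : 2 != 0 :> int); rewrite -/e; lia.
- by apply: bernstein0; rewrite pe.
- by apply: bernstein1; rewrite pe.
Qed.
End Bernstein.

(** * Finite relations, the affine generator and length zero elements *)

Section Proposition.
Variables (R : realType) (D : based_root_datum) (k : comPzRingType) (v : k).
Hypotheses (D_reduced : reduced D) (D_irreducible : irreducible D).
Hypothesis v_inv : invertible v.
Local Notation H := (@hecke D k (v ^+ 2)).
Local Notation Q := (v - rinv v).
Local Notation hroot := (highest_root D).
Implicit Types (g h : ext_weyl D) (i j : 'I_(ssrk D)) (l m : cochars D).
Implicit Types (a b : chars D) (w u : weyl D).

Lemma wlen_srefl i w :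
  wlen (srefl i * w)%g = (wlen w).+1 \/ wlen w = (wlen (srefl i * w)%g).+1.
Proof.
rewrite /wlen of_weylM -arefl_lift; set g := of_weyl w.
have e : elen (arefl (lift ord0 i) * g)%g = elen (g^-1 * arefl (lift ord0 i))%g.
  rewrite -elenV invgM; congr (elen (_ * _)%g).
  by apply: (mulgI (arefl (lift ord0 i))); rewrite mulgV arefl2.
by rewrite e -(elenV g); exact: elen_step_dich.
Qed.

Lemma tfin_srefl_mul i w : tfin R v (srefl i) * tfin R v w =
  if (wlen w < wlen (srefl i * w)%g)%N then tfin R v (srefl i * w)%g
  else tfin R v (srefl i * w)%g + Q *: tfin R v w.
Proof.
rewrite !tfinE //; have s1 : elen (of_weyl (srefl i)) = 1%N.
  by rewrite -arefl_lift elen_arefl.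
have [e|e] := wlen_srefl i w; rewrite e.
  by rewrite ltnSn of_weylM nTM // -of_weylM s1 add1n.
rewrite ltnNge leqnSn /=.
(* When [s_i w] is shorter, splitting off the factor for [s_i] leaves a square for the quadratic
   relation. *)
have e2 : nT v (of_weyl (srefl i)) * nT v (of_weyl (srefl i * w)%g) = nT v (of_weyl w) :> H.
  have ss : (srefl i * (srefl i * w) = w)%g by rewrite mulgA srefl2 mul1g.
  by rewrite nTM -of_weylM ss // s1 add1n.
rewrite -{1}e2 mulrA -arefl_lift nT_arefl2 // mulrDl mul1r -hecke_scalerAl.
by rewrite arefl_lift e2 addrC.
Qed.

Lemma highest_coroot_dominant : dominant (coroot hroot).
Proof.
move=> i; apply: (maximal_root_pairing D_reduced (highest_root_maximal D_reduced D_irreducible)).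
by case/posrootP: (posroot_simple i).
Qed.

Lemma Phi_step0_mul_tfin :
  Phi_step v (ord0, true) * tfin R v (refl hroot) = theta R v (coroot hroot).
Proof.
have ht := highest_root_root D_reduced D_irreducible.
have pt := posroot_highest D_reduced D_irreducible.
rewrite theta_dominant ?tfinE //; last exact: highest_coroot_dominant.
have refl2 : (refl hroot * refl hroot = 1)%g by rewrite -{1}refl_inv // mulVg.
rewrite /Phi_step /= nTM.
  by rewrite arefl0; congr (nT v (_, _)); rewrite ?refl2 //= weyl0 addr0.
have s0V : ((arefl ord0)^-1 = arefl ord0 :> ext_weyl D)%g.
  by apply: (mulgI (arefl ord0)); rewrite mulgV arefl2.
have rV : ((of_weyl (refl hroot))^-1 = of_weyl (refl hroot))%g.
  by rewrite -of_weylV refl_inv.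
have wr : wall_root ord0 (of_weyl (refl hroot)) = hroot.
  by rewrite /wall_root affine_simple0 weyl_charN weyl_char_refl // charefl_self // opprK.
rewrite -elenV invgM s0V rV elen_arefl //.
(* The step of type 0 from [s_theta] moves the offset at [theta] from -1 to -2, so the lengths
   add. *)
have := elen_step D_reduced D_irreducible ord0 (of_weyl (refl hroot)).
rewrite /upward wr pt absroot_id // offset_of_weyl refl_inv // weyl_char_refl //.
rewrite charefl_self // posrootN // pt /=.
by move: (elen _) (elen (_ * _)%g) => X Y; lia.
Qed.

(** If [w] kept a simple root orthogonal to [l] positive, [w s_i] would be a longer element of the
    stabilizer. A positive root orthogonal to the dominant [l] is a sum of such simple roots. *)
Lemma longest_stabilizer_neg l w a : dominant l -> longest (stabilizer l) w ->
  posroot a -> pairing a l = 0 -> ~~ posroot (weyl_char w a).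
Proof.
move=> dl [wl wmax] pa al.
have hs i : pairing (simple i) l = 0 -> ~~ posroot (weyl_char w (simple i)).
  move=> il; apply/negP => p.
  have : (wlen (w * srefl i)%g <= wlen w)%N.
    by apply: wmax; rewrite /stabilizer /= /corefl il mulr0z subr0.
  have := elen_step D_reduced D_irreducible (lift ord0 i) (of_weyl w).
  rewrite /wlen of_weylM -arefl_lift /upward /wall_root affine_simple_lift.
  rewrite p absroot_id // offset_of_weyl weyl_charK posroot_simple.
  by move: (elen _) (elen (_ * _)%g) => X Y /=; lia.
have w0 : weyl_char w 0 = 0.
  by apply: (addrI (weyl_char w 0)); rewrite -weyl_charD !addr0.
have [ra da] := posrootP _ pa.
rewrite -posrootN ?weyl_char_root //; apply/posrootP.
split; first by rewrite opp_rootE weyl_char_root.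
move/dom0P: da => [c ac]; have c0 i : (0 < c i)%N -> pairing (simple i) l = 0.
  move=> ci; move: al; rewrite ac pairing_suml (bigD1 i) //= pairingMzl.
  set S := \sum_(_ | _) _; have : 0 <= S.
    by apply: sumr_ge0 => i1 _; rewrite pairingMzl mulr_ge0.
  by have := dl i; move: S (pairing _ l) => S x; nia.
rewrite ac (big_morph _ (weyl_charD w) w0) -sumrN.
elim/big_rec: _ => [|i y _ dy]; first exact: dom00.
apply: dom0D => //; rewrite weyl_charMz -mulNrz.
have [->|ci] := posnP (c i); first exact: dom00.
apply: dom0Mn; have := hs _ (c0 i ci).
by rewrite -posrootN ?weyl_char_root ?simple_root // => /posrootP[].
Qed.

Lemma theta_len0 (tau : ext_weyl D) l w0 w' : elen tau = 0%N ->
    ext_act tau 0 = rembed R l ->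
    longest [set: weyl D]%classic w0 -> longest (stabilizer l) w' ->
  theta R v l = hT (v ^+ 2) tau * tfin R v (w0 * w')%g.
Proof.
move=> tau0 tl [_ w0max] hw'.
have {tl} tl : tau.1 = l.
  apply: (@rembed_inj R); rewrite -tl; apply: rpairing_ext => a.
  by rewrite rpairing_ext_act rpairing0r addr0 rpairing_rembed.
(* Length zero forces the offsets of the base alcove, so [l] is minuscule: positive roots take only
   the values 0 and 1 on it. *)
have off a : posroot a -> pairing a l = (~~ posroot (weyl_char (tau.2^-1)%g a))%:Z.
  move=> pa; have := elen_eq0_offset tau0 (posroot_root pa).
  by rewrite offset1_pos // /offset tl; lia.
have dl : dominant l by move=> i; rewrite off ?posroot_simple.
have hw0 : longest (stabilizer (0 : cochars D)) w0.
  by split=> [|u _]; [exact: weyl0 | exact: w0max].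
have d0 : dominant (0 : cochars D) by move=> i; rewrite pairing0r.
have w0_neg a : posroot a -> ~~ posroot (weyl_char w0 a).
  by move=> pa; apply: longest_stabilizer_neg pa (pairing0r a).
have w'l : (w'^-1)%g l = l by rewrite -{1}hw'.1 -weylM mulVg.
have w'_pos a : posroot a -> 0 < pairing a l -> posroot (weyl_char w' a).
  move=> pa al; case: (boolP (posroot _)) => // h.
  have ra := weyl_char_root w' (posroot_root pa).
  rewrite -posrootN // in h; have := dominant_pairing dl h.
  by rewrite pairingNl pairing_weyl_char w'l; lia.
(* Let [b = tau.2 a] with [a] positive. If [b] is positive then [<b, l> = 0] and [w'] makes it
   negative; otherwise [<- b, l> = 1] and [w'] keeps [- b] positive. Either way [w' b] is negative,
   and [w0] makes it positive. *)
have e : (w0 * w' * tau.2 = 1)%g.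
  apply: (weyl_eq1 D_reduced) => a pa; rewrite !weyl_charM.
  set b := weyl_char tau.2 a.
  have rb : b \in roots D by exact/weyl_char_root/posroot_root.
  have rwb : weyl_char w0 (weyl_char w' b) \in roots D by do 2!apply: weyl_char_root.
  have ub : weyl_char (tau.2^-1)%g b = a by rewrite weyl_charK.
  case: (boolP (posroot b)) => pb.
    have bl := off _ pb; rewrite ub pa /= in bl.
    have n := longest_stabilizer_neg dl hw' pb bl.
    rewrite -posrootN in n; last by apply: weyl_char_root.
    by have := w0_neg _ n; rewrite weyl_charN posrootN // negbK.
  rewrite -posrootN // in pb; have bl := off _ pb.
  rewrite weyl_charN ub posrootN ?posroot_root // pa /= in bl.
  have n := w'_pos _ pb; rewrite bl in n; have {}n := n isT.
  by have := w0_neg _ n; rewrite !weyl_charN posrootN // negbK.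
have -> : (w0 * w' = tau.2^-1)%g by rewrite -[RHS]mul1g -e -!mulgA mulgV mulg1.
rewrite theta_dominant // tfinE // -nT_len0 // nTM; last first.
  by rewrite elen_mull_len0 // tau0.
congr (nT v _); congr pair; rewrite ?mulgV //=.
by rewrite weyl0 addr0 tl.
Qed.
End Proposition.

Theorem proposition3p3p1 (R : realType) (D : based_root_datum)
    (k : comPzRingType) (v : k)
    (D_reduced : reduced D) (D_irreducible : irreducible D)
    (v_invertible : invertible v)
    (tau : ext_weyl D) (tau_omega : elen tau = 0%N)
    (lambda mu : cochars D) (w : weyl D) (i : 'I_(ssrk D))
    (phi : chars D) (phi_pos : posroot phi)
    (phi_wall : is_wall (base_alcove D R) (hyp R phi 1))
    (phi_not_chamber_wall : ~ is_wall (dominant_chamber D R) (hyp R phi 1)) :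
  [/\ theta R v lambda * theta R v mu = theta R v (lambda + mu),
      tfin R v (srefl i) * tfin R v w =
        if (wlen w < wlen (srefl i * w)%g)%N then tfin R v (srefl i * w)%g
        else tfin R v (srefl i * w)%g + (v - rinv v) *: tfin R v w,
      tfin R v (srefl i) * theta R v lambda =
        theta R v (srefl i lambda) * tfin R v (srefl i) +
        (v - rinv v) *: bernstein_frac R v (simple i) lambda,
      Phi_step v (ord0, true) * tfin R v (refl phi) = theta R v (coroot phi) &
      ext_act tau 0 = rembed R lambda ->
      forall w0 w' : weyl D,
        longest [set: weyl D]%classic w0 -> longest (stabilizer lambda) w' ->
        theta R v lambda = hT (v ^+ 2) tau * tfin R v (w0 * w')%g].
Proof.
split.
- exact: thetaD.
- exact: tfin_srefl_mul.
- by rewrite tfinE //; exact: bernsteinP.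
- rewrite (base_alcove_wall D_reduced D_irreducible phi_pos phi_wall).
  exact: Phi_step0_mul_tfin.
- by move=> tl w0 w'; exact: theta_len0.
Qed.
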